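(* Let $d\ge 2$ and let $\mathscr{E}$ be a rotund family of enhancements for bond percolation on $\mathbb{Z}^d$. Then for any $p>q_c(\mathscr{E})$ there is an $N\in\mathbb{N}$ such that $P_N(p)$ percolates.
   Context: An enhancement is a pair $(T,S)$ where $T$ is a finite subgraph of the nearest-neighbor graph $\mathbb{Z}^d$ and $S$ is a finite subgraph of the complete graph on the vertex set $\mathbb{Z}^d$, with $T\subset S$. In a family of enhancements $\mathscr{E}=\{(T_\alpha,S_\alpha)\}_{\alpha\in I}$, every enhancement appears at most once up to congruence and the origin is a vertex of every $S_\alpha$. Let $\Gamma_d$ be the group of maps $x\mapsto Ax+v$ with $v\in\mathbb{Z}^d$, $A\in SO(d)$, $A\mathbb{Z}^d=\mathbb{Z}^d$; congruence means equality up to an element of $\Gamma_d$. Write $\Lambda_n=[-n,n]^d$. The radius $r_\alpha$ of $(T_\alpha,S_\alpha)$ is the smallest $n$ for which $S_\alpha\subset\Lambda_n$. The family $\mathscr{E}$ is rotund if there is a $c>0$ such that for every $(T_\alpha,S_\alpha)\in\mathscr{E}$, $\Lambda_{\lfloor c r_\alpha\rfloor}\subset S_\alpha$, meaning that $S_\alpha$ contains all vertices of $\mathbb{Z}^d$ in $\Lambda_{\lfloor c r_\alpha\rfloor}$ and all nearest-neighbor edges between them. Let $P=P(p)$, $p\in[0,1]$, be Bernoulli bond percolation on the nearest-neighbor graph $\mathbb{Z}^d$ with edge probability $p$, with law $\mathbb{P}_p$. For integers $k\ge 0$, $\mathscr{F}_k$ is the collection of enhancements $(T,S)\in\mathscr{E}$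 such that the $\ell^\infty$ diameter of (the vertex set of) $S$ lies in $[2^k,2^{k+1})$. The random graph $P_k=P_k(p)$ is obtained from $P$ by adding $\gamma(S)$ for every $(T,S)\in\bigcup_{j=0}^k\mathscr{F}_j$ and $\gamma\in\Gamma_d$ with $\gamma(T)\subset P$. A random graph percolates if it contains an infinite connected component with probability one. For $(T,S)\in\mathscr{F}\subset\mathscr{E}$ and $\gamma\in\Gamma_d$ with $\gamma(T)\subset P$, $(\gamma(T),\gamma(S))$ is called an activated enhancement of $\mathscr{F}$ with anchor $\gamma(0)$. Let $G_k$ be the event that the anchor of some activated enhancement of $\mathscr{F}_k$ is contained in $\Lambda_{2^k}$. Define $$q_c(\mathscr{E})=\sup\{p:\limsup_{k\to\infty}\mathbb{P}_p(G_k)=0\},$$ the supremum being taken in $[0,1]$. *)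

(* Defs.v *)
From HB Require Import structures.
From mathcomp Require Import all_boot all_order all_algebra.
From mathcomp Require Import all_classical all_reals all_analysis.
From Stdlib Require Import Relation_Operators.

Set Implicit Arguments.
Unset Strict Implicit.
Unset Printing Implicit Defensive.

Import Order.TTheory GRing.Theory Num.Theory.

Local Open Scope classical_set_scope.
Local Open Scope ring_scope.

(** MathComp-Analysis, over an arbitrary [R : realType]. *)

Notation Zd d := 'cV[int]_d.

(** ** Graphs on the vertex set Z^d *)

(** An edge is an unordered pair [[set x; y]] of distinct vertices.  The record
    is raw data: that edges join vertices of the graph is [is_graph]. *)
Record graph (d : nat) := Graph {
  vert : set (Zd d);
  edges : set (set (Zd d)) }.

Definition is_graph d (G : graph d) : Prop :=
  forall e, edges G e ->
    exists x y, [/\ vert G x, vert G y, x <> y & e = [set x; y]].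

Definition graph_le d (G H : graph d) : Prop :=
  vert G `<=` vert H /\ edges G `<=` edges H.

Definition gunion d (G H : graph d) : graph d :=
  Graph (vert G `|` vert H) (edges G `|` edges H).

Definition gbigcup d (J : Type) (D : set J) (G : J -> graph d) : graph d :=
  Graph (\bigcup_(j in D) vert (G j)) (\bigcup_(j in D) edges (G j)).

Definition gimage d (g : Zd d -> Zd d) (G : graph d) : graph d :=
  Graph (g @` vert G) ((fun e => g @` e) @` edges G).

Definition adj d (G : graph d) (x y : Zd d) : Prop :=
  x <> y /\ edges G [set x; y].

Definition component d (G : graph d) (x : Zd d) : set (Zd d) :=
  [set y | clos_refl_trans (Zd d) (adj G) x y].

Definition has_infinite_component d (G : graph d) : Prop :=
  exists2 x, vert G x & infinite_set (component G x).

(** The bond [(x, i)] stands for the edge between [x] and [x + e_i]; this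
    enumerates the edges of the nearest-neighbor graph without repetition. *)
Definition bond (d : nat) : Type := (Zd d * 'I_d)%type.

Definition bond_edge d (b : bond d) : set (Zd d) :=
  [set b.1; b.1 + delta_mx b.2 0].

Definition nn_graph (d : nat) : graph d := Graph setT (range (@bond_edge d)).

Definition complete_graph (d : nat) : graph d :=
  Graph setT [set e | exists x y : Zd d, x <> y /\ e = [set x; y]].

Definition box (d : nat) (n : int) : set (Zd d) :=
  [set x | forall i, `|x i 0| <= n].

(** All of Z^d inside the box, with all nearest-neighbor edges in between. *)
Definition box_graph (d : nat) (n : int) : graph d :=
  Graph (@box d n) [set e | edges (nn_graph d) e /\ e `<=` @box d n].

Definition linf_dist d (x y : Zd d) : nat := (\max_(i < d) absz (x i 0 - y i 0)%R)%N.

Definition diameter (R : realType) d (G : graph d) : R :=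
  sup [set (linf_dist x y)%:R | x in vert G & y in vert G].

Definition is_radius d (G : graph d) (r : nat) : Prop :=
  vert G `<=` @box d r /\ forall n : nat, vert G `<=` @box d n -> (r <= n)%N.

(** ** The group of orientation-preserving isometries of the lattice *)

Definition lattice_vec (R : realType) d (x : Zd d) : 'cV[R]_d := map_mx intr x.

(** Restrictions to Z^d of x |-> Ax + v, with A in SO(d) and A Z^d = Z^d. *)
Definition Gamma (R : realType) (d : nat) : set (Zd d -> Zd d) :=
  [set g | exists (A : 'M[R]_d) (v : Zd d),
    [/\ A^T *m A = 1%:M,
        \det A = 1,
        [set A *m lattice_vec R x | x in [set: Zd d]] = range (@lattice_vec R d) &
        forall x, lattice_vec R (g x) = A *m lattice_vec R x + lattice_vec R v]].

(** ** Enhancements *)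

Record enhancement (d : nat) := Enhancement {
  enhT : graph d;
  enhS : graph d;
  enhT_graph : is_graph enhT;
  enhS_graph : is_graph enhS;
  enhT_finite : finite_set (vert enhT);
  enhS_finite : finite_set (vert enhS);
  enhT_nn : graph_le enhT (nn_graph d);
  enhS_complete : graph_le enhS (complete_graph d);
  enhTS : graph_le enhT enhS }.

Definition congruent (R : realType) d (a b : enhancement d) : Prop :=
  exists2 g, Gamma R g & gimage g (enhT a) = enhT b /\ gimage g (enhS a) = enhS b.

Definition enhancement_family (R : realType) d (I : Type)
    (E : I -> enhancement d) : Prop :=
  (forall i j, congruent R (E i) (E j) -> i = j) /\
  (forall i, vert (enhS (E i)) 0).

Definition rotund (R : realType) d (I : Type) (E : I -> enhancement d) : Prop :=
  exists2 c : R, 0 < c & forall i r, is_radius (enhS (E i)) r ->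
    graph_le (box_graph d (Num.floor (c * r%:R))) (enhS (E i)).

(** The indices of the enhancements belonging to F_k. *)
Definition scale (R : realType) d (I : Type) (E : I -> enhancement d)
    (k : nat) : set I :=
  [set i | (2 ^+ k : R) <= diameter R (enhS (E i)) < 2 ^+ k.+1].

(** ** Bernoulli bond percolation *)

Definition bond_cylinders (d : nat) : set (set (bond d -> bool)) :=
  [set [set w | w b = true] | b in [set: bond d]].

(** Configurations, with the product sigma-algebra. *)
Definition config (d : nat) := g_sigma_algebraType (@bond_cylinders d).

(** [mu] is the product over all bonds of Bernoulli measures of parameter [p];
    the values on finite cylinders determine [mu] on the sigma-algebra. *)
Definition bernoulli_percolation (R : realType) d (p : R)
    (mu : probability (config d) R) : Prop :=
  forall (s : seq (bond d)) (a : bond d -> bool), uniq s ->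
    mu [set w | forall b, b \in s -> w b = a b] =
    (\prod_(b <- s) (if a b then p else 1 - p))%:E.

Definition percolation_graph d (w : config d) : graph d :=
  Graph setT (@bond_edge d @` [set b | w b = true]).

Definition activated (R : realType) d (I : Type) (E : I -> enhancement d)
    (D : set I) (w : config d) : set (I * (Zd d -> Zd d)) :=
  [set z | [/\ D z.1, Gamma R z.2 &
               graph_le (gimage z.2 (enhT (E z.1))) (percolation_graph w)]].

(** The graph P_k. *)
Definition enhanced_graph (R : realType) d (I : Type) (E : I -> enhancement d)
    (k : nat) (w : config d) : graph d :=
  gunion (percolation_graph w)
    (gbigcup (activated R E (\bigcup_(j in [set j | (j <= k)%N]) scale R E j) w)
             (fun z => gimage z.2 (enhS (E z.1)))).

Definition percolates (R : realType) d (mu : probability (config d) R)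
    (G : config d -> graph d) : Prop :=
  {ae mu, forall w, has_infinite_component (G w)}.

(** The event G_k. *)
Definition anchor_event (R : realType) d (I : Type) (E : I -> enhancement d)
    (k : nat) : set (config d) :=
  [set w | exists2 z, activated R E (scale R E k) w z &
                      @box d (2 ^ k)%N (z.2 0)].

(** [Pr p] is meant to be the percolation law of parameter [p].  The supremum is
    taken in [0, 1]: for the empty set, [sup set0 = 0]. *)
Definition q_c (R : realType) d (Pr : R -> probability (config d) R)
    (I : Type) (E : I -> enhancement d) : R :=
  sup [set p | 0 <= p <= 1 /\
               limn_esup (fun k => Pr p (anchor_event R E k)) = 0%E].

(* Main.v *)
Require Import Defs.
From mathcomp Require Import all_boot all_order all_algebra.
From mathcomp Require Import all_classical all_reals all_analysis.
From mathcomp Require Import ring lra zify.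
From Stdlib Require Import Relation_Operators.

Set Implicit Arguments.
Unset Strict Implicit.
Unset Printing Implicit Defensive.

Import Order.TTheory GRing.Theory Num.Theory.

Local Open Scope classical_set_scope.
Local Open Scope ring_scope.

(** A sharp threshold makes anchors dense at one large scale, and a
    renormalization argument at that scale produces the infinite component.

    Since [q_c < p], there are [p1 < p] and [delta > 0] such that the anchor
    event of scale [k] has probability at least [delta] at density [p1] for
    infinitely many [k].  Wrap the lattice onto the torus of side
    [m = 2 ^ (k + 3)], wide enough for the activation of one enhancement of
    scale [k] not to notice the wrapping, and let [H] be the event that some
    enhancement of scale [k] is activated anywhere on the torus.  It is
    increasing, it is invariant under translations, and its probability at
    [p1] is at least [delta].

    Sharp threshold.  By Russo's formula ([russo]) the probability of [H] has
    the total influence as derivative, so at some density [q] between [p1] and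
    [p] the total influence is at most [1 / (p - p1)]; by translation
    invariance every single influence is then of order [m ^ - d].  An
    inequality of Talagrand type ([talagrand]) bounds the variance of an event
    by its total influence divided by a logarithm that grows as the largest
    influence shrinks.  It comes from the logarithmic Sobolev
    inequality ([log_sobolev]), applied to each martingale difference of the
    indicator.  So the variance of [H] at [q] tends to 0 with [1 / m]; as the
    probability of [H] stays above [delta], it is close to 1 at [q], hence at
    [p] ([sharp_threshold], [tprob_sharp]).

    Dense anchors.  A number [K] of translates of a cube of side
    [s = 2 ^ (k - h)] covers the torus, and [K] depends on [h] and [d] only.
    The absence of anchors from a cube is a decreasing event, so by Harris'
    inequality ([harris_prod]) the probability that [H] fails is at least the
    [K]-th power of the probability that one cube has no anchor.  The latter
    is therefore as small as desired ([tprob_cover], [dense_anchors]).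

    Renormalization.  Rotundity gives an [h] for which every activated
    enhancement of scale [k] contains the box of radius [2 * s] around its
    anchor ([scale_fill]).  Cut a quarter of a coordinate plane into cells of
    side [s] and call a cell good if it has an anchor: the anchors of adjacent
    good cells are connected to each other in [P_k] ([hub_connected]).  Cells
    at a bounded distance in units of [s] are independent, and bad cells are
    rare, so a Peierls argument applies: a finite cluster of good cells would
    be cut off by a path of bad cells from one axis to the other
    ([boundary_path]), and by Borel-Cantelli such paths start from finitely
    many points only ([renormalized_percolation]). *)

(** * Averages over finitely many coordinates *)

Section Averages.
Variables (R : realType) (J : eqType).
Implicit Types (a : J -> bool) (f g h : (J -> bool) -> R) (s : seq J).

Definition upd a (j : J) (x : bool) : J -> bool :=
  fun i => if i == j then x else a i.

Lemma updK a j x y : upd (upd a j x) j y = upd a j y.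
Proof. by apply/funext => i; rewrite /upd; case: eqP. Qed.

Lemma updC a i j x y : i != j -> upd (upd a i x) j y = upd (upd a j y) i x.
Proof.
move=> ij; apply/funext => l; rewrite /upd.
by case: (eqVneq l j) => [->|//]; rewrite eq_sym (negbTE ij).
Qed.

Lemma upd_id a j : upd a j (a j) = a.
Proof. by apply/funext => i; rewrite /upd; case: eqP => [->|]. Qed.

Definition avg1 (q : R) (j : J) f : (J -> bool) -> R :=
  fun a => q * f (upd a j true) + (1 - q) * f (upd a j false).

(** Expectation over independent Bernoulli states of parameter [q] for the
    coordinates in [s], the other coordinates being kept.  Probabilities on
    finitely many bonds are handled through these commuting projections, so
    that no enumeration of configurations is needed. *)
Definition avg (q : R) s f : (J -> bool) -> R := foldr (avg1 q) f s.

(** For the indicator of an increasing event this is the indicator that [j]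
    is pivotal, and its average is the influence of [j]. *)
Definition grad (j : J) f : (J -> bool) -> R :=
  fun a => f (upd a j true) - f (upd a j false).

Definition ignores (j : J) f := forall a x, f (upd a j x) = f a.

Lemma grad_ignores j f : ignores j f -> grad j f = fun=> 0.
Proof. by move=> fj; apply/funext => a; rewrite /grad !fj subrr. Qed.

Lemma ignores_grad j f : ignores j (grad j f).
Proof. by move=> a x; rewrite /grad !updK. Qed.

Lemma ignores_avg1 q j f : ignores j (avg1 q j f).
Proof. by move=> a x; rewrite /avg1 !updK. Qed.

Lemma avg1_id q j f : ignores j f -> avg1 q j f = f.
Proof. by move=> fj; apply/funext => a; rewrite /avg1 !fj; ring. Qed.

Lemma avg1C q i j f : avg1 q i (avg1 q j f) = avg1 q j (avg1 q i f).
Proof.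
case: (eqVneq i j) => [->//|ij]; apply/funext => a.
by rewrite /avg1 !(updC _ _ _ ij); ring.
Qed.

Lemma ignores_avg1_neq q i j f : ignores j f -> ignores j (avg1 q i f).
Proof.
case: (eqVneq i j) => [->|ij] fj; first exact: ignores_avg1.
by move=> a x; rewrite /avg1 -!(updC _ _ _ ij) !fj.
Qed.

Lemma grad_avg1 q i j f : i != j -> grad j (avg1 q i f) = avg1 q i (grad j f).
Proof.
move=> ij; apply/funext => a.
by rewrite /grad /avg1 -!(updC _ _ _ ij); ring.
Qed.

Lemma ignores_avg q s j f : ignores j f -> ignores j (avg q s f).
Proof. by move=> fj; elim: s => //= i s IH; apply: ignores_avg1_neq. Qed.

Lemma avg1_avg q j s f : avg1 q j (avg q s f) = avg q s (avg1 q j f).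
Proof. by elim: s => //= i s <-; rewrite avg1C. Qed.

Lemma ignores_avg_in q s j f : j \in s -> ignores j (avg q s f).
Proof.
elim: s => //= i s IH; rewrite inE => /predU1P[->|/IH]; first exact: ignores_avg1.
exact: ignores_avg1_neq.
Qed.

Lemma avg_id q s f : (forall j, j \in s -> ignores j f) -> avg q s f = f.
Proof.
elim: s => //= i s IH fs; rewrite IH ?avg1_id //.
  by apply: fs; rewrite mem_head.
by move=> j js; apply: fs; rewrite inE js orbT.
Qed.

Lemma avg_idem q s f : avg q s (avg q s f) = avg q s f.
Proof. by apply: avg_id => j; apply: ignores_avg_in. Qed.

Lemma grad_avg q s j f : j \notin s -> grad j (avg q s f) = avg q s (grad j f).
Proof.
elim: s => //= i s IH; rewrite inE negb_or eq_sym => /andP[ij js].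
by rewrite grad_avg1 // IH.
Qed.

Lemma avg_cat q s t f : avg q (s ++ t) f = avg q s (avg q t f).
Proof. by rewrite /avg foldr_cat. Qed.

(** The operators [avg1 q j] commute, so the order of the list is irrelevant. *)
Lemma perm_avg q s t f : perm_eq s t -> avg q s f = avg q t f.
Proof.
elim: s t => [|i s IH] t.
  by rewrite perm_sym => /perm_nilP ->.
move=> /[dup] /perm_mem/(_ i); rewrite mem_head => /esym it.
case/splitPr: it => t1 t2.
rewrite perm_sym -(cat1s i t2) perm_catCA /= perm_cons perm_sym => /IH st.
by rewrite [LHS]/= st !avg_cat /= avg1_avg.
Qed.

Lemma avgD q s f g a : avg q s (fun a => f a + g a) a = avg q s f a + avg q s g a.
Proof.
elim: s a => //= i s IH a; rewrite /avg1 !IH; ring.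
Qed.

Lemma avgZ q s c f a : avg q s (fun a => c * f a) a = c * avg q s f a.
Proof. by elim: s a => //= i s IH a; rewrite /avg1 !IH; ring. Qed.

Lemma avg_cst q s (c : R) a : avg q s (fun=> c) a = c.
Proof. by rewrite avg_id. Qed.

Lemma avgB q s f g a : avg q s (fun a => f a - g a) a = avg q s f a - avg q s g a.
Proof.
rewrite -mulN1r -avgZ -avgD; congr (avg q s _ a).
by apply/funext => b; rewrite mulN1r.
Qed.

Lemma avgM_ignores q s f g a : (forall j, j \in s -> ignores j f) ->
  avg q s (fun a => f a * g a) a = f a * avg q s g a.
Proof.
elim: s a => //= i s IH a fs.
have fi : ignores i f by apply: fs; rewrite mem_head.
rewrite /avg1 !IH ?fi; first ring.
all: by move=> j js; apply: fs; rewrite inE js orbT.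
Qed.

(** Independence of functions of disjoint sets of coordinates. *)
Lemma avg_indep q s t f g a :
  (forall j, j \in t -> ignores j f) -> (forall j, j \in s -> ignores j g) ->
  avg q (s ++ t) (fun a => f a * g a) a = avg q s f a * avg q t g a.
Proof.
move=> ft gs; rewrite avg_cat mulrC.
rewrite (_ : avg q t _ = fun a => avg q t g a * f a); last first.
  by apply/funext => b; rewrite avgM_ignores // mulrC.
by apply: avgM_ignores => j js; apply/ignores_avg/gs.
Qed.

Variable q : R.
Hypothesis q01 : 0 <= q <= 1.
Notation E := (avg q).

Lemma ler_avg s f g a : (forall b, f b <= g b) -> E s f a <= E s g a.
Proof.
move=> fg; elim: s a => //= i s IH a; rewrite /avg1.
move: q01 => /andP[q0 q1].
by apply: lerD; apply: ler_wpM2l => //; rewrite subr_ge0.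
Qed.

Lemma avg_ge0 s f a : (forall b, 0 <= f b) -> 0 <= E s f a.
Proof. by move=> f0; rewrite -(avg_cst q s 0 a); apply: ler_avg. Qed.

Lemma avg_le1 s f a : (forall b, f b <= 1) -> E s f a <= 1.
Proof. by move=> f1; rewrite -(avg_cst q s 1 a); apply: ler_avg. Qed.

Lemma ler_norm_avg s f a : `|E s f a| <= E s (fun b => `|f b|) a.
Proof.
rewrite ler_norml -mulN1r -avgZ; apply/andP; split; apply: ler_avg => b.
  by rewrite mulN1r lerNl ler_normr lexx orbT.
exact: ler_norm.
Qed.

Definition increasing f := forall a j, f (upd a j false) <= f (upd a j true).

Lemma increasing_avg s f : increasing f -> increasing (E s f).
Proof.
move=> fi a j; elim: s a => //= i s IH a; rewrite /avg1.
case: (eqVneq i j) => [->|ij]; first by rewrite !updK.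
by rewrite -!(updC _ _ _ ij); move: q01 => /andP[q0 q1];
  apply: lerD; apply: ler_wpM2l; rewrite ?subr_ge0.
Qed.

(** Positive association, by induction on the coordinates: averaging over one
    coordinate makes the covariance grow by [q * (1 - q)] times the product
    of two nonnegative increments. *)
Lemma harris s f g a : increasing f -> increasing g ->
  E s f a * E s g a <= E s (fun b => f b * g b) a.
Proof.
move=> fi gi; elim: s a => //= i s IH a.
apply: (@le_trans _ _ (avg1 q i (fun b => E s f b * E s g b) a)); last first.
  by rewrite /avg1; move: q01 => /andP[q0 q1];
    apply: lerD; apply: ler_wpM2l; rewrite ?subr_ge0.
rewrite /avg1.
have := increasing_avg s fi a i; have := increasing_avg s gi a i.
move: (E s f _) (E s f _) (E s g _) (E s g _) => x y z t zt xy.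
rewrite -subr_ge0.
rewrite [leRHS](_ : _ = q * (1 - q) * ((x - y) * (z - t))); last by ring.
by move: q01 => /andP[q0 q1]; apply: mulr_ge0; apply: mulr_ge0;
  rewrite ?subr_ge0.
Qed.

Definition decreasing f := forall a j, f (upd a j true) <= f (upd a j false).

Lemma harris_decreasing s f g a : decreasing f -> decreasing g ->
  E s f a * E s g a <= E s (fun b => f b * g b) a.
Proof.
move=> fd gd; have := @harris s (fun b => -1 * f b) (fun b => -1 * g b) a.
rewrite !avgZ mulrACA mulrNN mulr1 mul1r => h.
rewrite (_ : (fun b => f b * g b) = fun b => -1 * f b * (-1 * g b)).
  by apply: h => b j; rewrite !mulN1r lerN2.
by apply/funext => b; ring.
Qed.

Lemma harris_prod s T (r : seq T) (F : T -> (J -> bool) -> R) a :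
  (forall t b, 0 <= F t b) -> (forall t, decreasing (F t)) ->
  \prod_(t <- r) E s (F t) a <= E s (fun b => \prod_(t <- r) F t b) a.
Proof.
move=> F0 Fi; elim: r => [|t r IH].
  rewrite big_nil (_ : (fun _ => _) = fun=> 1) ?avg_cst //.
  by apply/funext => b; rewrite big_nil.
rewrite big_cons (_ : (fun _ => _) = fun b => F t b * \prod_(t <- r) F t b).
  apply: (@le_trans _ _ (E s (F t) a * E s (fun b => \prod_(t <- r) F t b) a)).
    by apply: ler_wpM2l => //; apply: avg_ge0.
  apply: harris_decreasing => //.
  move=> b j; elim: {IH} r => [|u r IH]; first by rewrite !big_nil.
  by rewrite !big_cons; apply: ler_pM => //; [exact: prodr_ge0 | exact: Fi].
by apply/funext => b; rewrite big_cons.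
Qed.

(** The average of [(t * f + u * g) ^+ 2] is a nonnegative quadratic form in
    [(t, u)], so its discriminant has a sign; three values of [(t, u)] are
    enough to see it. *)
Lemma cauchy_schwarz s f g a :
  (E s (fun b => f b * g b) a) ^+ 2 <=
  E s (fun b => f b ^+ 2) a * E s (fun b => g b ^+ 2) a.
Proof.
set x := E s _ a; set y := E s _ a; set z := E s _ a.
have key t u : 0 <= t ^+ 2 * y + 2 * t * u * x + u ^+ 2 * z.
  have : 0 <= E s (fun b => (t * f b + u * g b) ^+ 2) a.
    by apply: avg_ge0 => b; apply: sqr_ge0.
  rewrite (_ : (fun _ => _) = fun b => t ^+ 2 * f b ^+ 2 +
    (2 * t * u * (f b * g b) + u ^+ 2 * g b ^+ 2)).
    by rewrite avgD avgD !avgZ addrA.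
  by apply/funext => b; ring.
have y0 : 0 <= y by apply: avg_ge0 => b; apply: sqr_ge0.
have z0 : 0 <= z by apply: avg_ge0 => b; apply: sqr_ge0.
have := key z (- x); have := key x (- y); have := key 1 (- x).
have [->|zn0] := eqVneq z 0.
  have [->|yn0] := eqVneq y 0; first by nra.
  by have : 0 < y by [rewrite lt_neqAle eq_sym yn0]; nra.
by have : 0 < z by [rewrite lt_neqAle eq_sym zn0]; nra.
Qed.

End Averages.

(** * The logarithmic Sobolev inequality *)

Section LogSobolev.
Variables (R : realType) (J : eqType).
Implicit Types (a : J -> bool) (f g h : (J -> bool) -> R) (s : seq J).

Lemma ln_le_subr1 (x : R) : 0 < x -> ln x <= x - 1.
Proof. by move=> x0; have := le_ln1Dx (x := x - 1); rewrite addrCA subrr addr0; apply; lra. Qed.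

Lemma ln_ge_1subV (x : R) : 0 < x -> 1 - x^-1 <= ln x.
Proof.
move=> x0; have := ln_le_subr1 (x := x^-1); rewrite lnV ?posrE // invr_gt0 => /(_ x0).
lra.
Qed.

(** As [ln 0 = 0] by convention, this is continuous at [0], as entropy needs. *)
Definition xlnx (x : R) : R := x * ln x.

(** The entropy of a two-valued variable is at most its variance over its
    mean [m]; this is [ln x <= x - 1] at [u / m] and [v / m].  The
    factor [m] stands for the division by the mean, which may vanish. *)
Lemma ent_two_points (q u v m : R) : 0 <= q <= 1 -> 0 <= u -> 0 <= v ->
  m = q * u + (1 - q) * v ->
  m * (q * xlnx u + (1 - q) * xlnx v - xlnx m) <= q * (1 - q) * (u - v) ^+ 2.
Proof.
move=> /andP[q0 q1] u0 v0 mE.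
have m0 : 0 <= m by rewrite mE; nra.
have [->|mn0] := eqVneq m 0.
  by rewrite mul0r mulr_ge0 ?sqr_ge0 // mulr_ge0 // subr_ge0.
have mp : 0 < m by rewrite lt_neqAle eq_sym mn0.
have key x : 0 <= x -> m * xlnx x <= m * (x * ln m) + x * (x - m).
  rewrite le_eqVlt => /predU1P[<-|x0]; first by rewrite /xlnx !mul0r mulr0 addr0.
  have xm : 0 < x / m by rewrite divr_gt0.
  have := ln_le_subr1 xm; rewrite lnM ?posrE ?invr_gt0 // lnV ?posrE // => h.
  have /(ler_wpM2l (mulr_ge0 m0 (ltW x0))) := h.
  rewrite [leRHS](_ : _ = x * (x - m)); last by field.
  by rewrite /xlnx; lra.
have := ler_wpM2l q0 (key u u0).
have := @ler_wpM2l _ (1 - q) _ _ _ (key v v0); rewrite subr_ge0 => /(_ q1).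
rewrite [xlnx m]/xlnx.
rewrite (_ : _ * (u - v) ^+ 2 = q * (u * (u - m)) + (1 - q) * (v * (v - m))).
  rewrite (_ : m * ln m = q * (u * ln m) + (1 - q) * (v * ln m)); last first.
    by rewrite {1}mE; ring.
  by lra.
by rewrite mE; ring.
Qed.

Variable q : R.
Hypothesis q01 : 0 <= q <= 1.
Notation E := (avg q).

Lemma avg_upd s j h x : j \notin s ->
  E s (fun b => h (upd b j x)) = fun b => E s h (upd b j x).
Proof.
elim: s => //= i s IH; rewrite inE negb_or => /andP[ij js].
rewrite IH //; apply/funext => b; rewrite /avg1.
by rewrite !(updC _ _ _ ij).
Qed.

Definition ent s h a := E s (fun b => xlnx (h b)) a - xlnx (E s h a).

(** Induction on the coordinates.  By the chain rule, the entropy over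
    [j :: s] is the mean of the entropies over [s] plus the entropy in [j] of
    the partial average [G] of [g ^+ 2].  The two-point inequality bounds the
    latter by [q * (1 - q) * (u - v) ^+ 2 / m] for the two values [u] and [v]
    of [G].  Since [u - v] is the average of a product of [grad j g] and the
    sum of the two values of [g], Cauchy-Schwarz gives
    [(u - v) ^+ 2 <= 2 * (u + v) * D] with [D] the average of
    [grad j g ^+ 2], and [q * (1 - q) * (u + v) <= m].  The constant 2 does
    not depend on [q], thanks to the derivative [grad] being unnormalized. *)
Lemma log_sobolev s g a : uniq s ->
  ent s (fun b => g b ^+ 2) a <= 2 * \sum_(j <- s) E s (fun b => grad j g b ^+ 2) a.
Proof.
rewrite /ent; elim: s a => [a _|j s IH a /= /andP[js us]].
  by rewrite big_nil /= subrr mulr0.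
set h := fun b => g b ^+ 2.
rewrite big_cons mulrDr.
have [q0 q1] := andP q01.
set a1 := upd a j true; set a0 := upd a j false.
have -> : 2 * \sum_(i <- s) avg1 q j (E s (fun b => grad i g b ^+ 2)) a =
   q * (2 * \sum_(i <- s) E s (fun b => grad i g b ^+ 2) a1) +
   (1 - q) * (2 * \sum_(i <- s) E s (fun b => grad i g b ^+ 2) a0).
  by rewrite /avg1 big_split /= -!mulr_sumr; ring.
have := ler_wpM2l q0 (IH a1 us).
have := @ler_wpM2l _ (1 - q) _ _ _ (IH a0 us); rewrite subr_ge0 => /(_ q1).
set S1 := \sum_(i <- s) _; set S0 := \sum_(i <- s) _.
set u := E s h a1; set v := E s h a0.
have u0 : 0 <= u by apply: avg_ge0 => // b; apply: sqr_ge0.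
have v0 : 0 <= v by apply: avg_ge0 => // b; apply: sqr_ge0.
have -> : avg1 q j (E s h) a = q * u + (1 - q) * v by [].
rewrite {1}/avg1 -/a1 -/a0.
set D := avg1 q j _ a.
have DE : D = E s (fun b => grad j g b ^+ 2) a.
  rewrite /D avg1_id //; apply: ignores_avg => b x.
  by congr (_ ^+ 2); apply: ignores_grad.
have D0 : 0 <= D by rewrite DE; apply: avg_ge0 => // b; apply: sqr_ge0.
have uv : u - v = E s (fun b => grad j g b * (g (upd b j true) + g (upd b j false))) a.
  have -> : u - v = grad j (E s h) a by [].
  rewrite grad_avg //; congr (E s _ a); apply/funext => b.
  by rewrite /grad /h; ring.
have upv : E s (fun b => (g (upd b j true) + g (upd b j false)) ^+ 2) a <= 2 * (u + v).
  have fr x : E s (fun b => h (upd b j x)) a = E s h (upd a j x).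
    by rewrite avg_upd.
  rewrite mulrDr /u /v /a1 /a0 -!fr -!avgZ -avgD; apply: ler_avg => // b.
  by rewrite /h; have := sqr_ge0 (g (upd b j true) - g (upd b j false)); nra.
have uv2 : (u - v) ^+ 2 <= D * (2 * (u + v)).
  rewrite uv; apply: le_trans (cauchy_schwarz _ _ _ _ _) _ => //.
  by rewrite -DE; apply: ler_wpM2l.
set m := q * u + (1 - q) * v.
have em := ent_two_points q01 u0 v0 (erefl m).
have m0 : 0 <= m by rewrite addr_ge0 // mulr_ge0 // subr_ge0.
have qm : q * (1 - q) * (u + v) <= m.
  rewrite -subr_ge0 (_ : _ - _ = q ^+ 2 * u + (1 - q) ^+ 2 * v).
    by rewrite addr_ge0 // mulr_ge0 // sqr_ge0.
  by rewrite /m; ring.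
have fin : q * xlnx u + (1 - q) * xlnx v - xlnx m <= 2 * D.
  have [m_0|mn0] := eqVneq m 0.
    have qu := mulr_ge0 q0 u0.
    have qv : 0 <= (1 - q) * v by rewrite mulr_ge0 // subr_ge0.
    have qu0 : q * u = 0 by move: m_0; rewrite /m; lra.
    have qv0 : (1 - q) * v = 0 by move: m_0; rewrite /m; lra.
    rewrite m_0 /xlnx !mulrA qu0 qv0 !mul0r; lra.
  have mp : 0 < m by rewrite lt_neqAle eq_sym mn0.
  rewrite -(ler_pM2l mp); apply: le_trans em _.
  have : q * (1 - q) * (u - v) ^+ 2 <= q * (1 - q) * (D * (2 * (u + v))).
    by apply: ler_wpM2l => //; rewrite mulr_ge0 // subr_ge0.
  by have := ler_wpM2l D0 qm; lra.
by move: fin; lra.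
Qed.

(** A function whose first moment, bounded by [A], is much smaller than the root of its
    second moment [v] has large entropy.  For every [t > 0], the tangent
    bound [ln z >= 1 + ln t - t / z] turns the average of
    [g ^+ 2 * ln (g ^+ 2)] into first and second moments; [t = v / A] gives
    the claim, and [t] tending to 0 settles [v = 0]. *)
Lemma ent_sqr_ge s g a (A : R) : 0 < A -> E s (fun b => `|g b|) a <= A ->
  E s (fun b => g b ^+ 2) a * ln (E s (fun b => g b ^+ 2) a / A ^+ 2) <=
  ent s (fun b => g b ^+ 2) a.
Proof.
move=> A0 gA; set v := E s _ a.
have v0 : 0 <= v by apply: avg_ge0 => // b; apply: sqr_ge0.
have tangent (t y : R) : 0 < t ->
    2 * ((1 + ln t) * y ^+ 2) - 2 * t * `|y| <= xlnx (y ^+ 2).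
  move=> t0; rewrite -real_normK ?num_real // /xlnx.
  have := normr_ge0 y; rewrite le_eqVlt => /predU1P[<-|].
    by rewrite expr0n /=; lra.
  set z := `|y| => z0.
  have zt : 0 < z / t by rewrite divr_gt0.
  have := ln_ge_1subV zt; rewrite lnM ?posrE ?invr_gt0 // lnV ?posrE // invf_div.
  move=> /(ler_wpM2l (ltW (exprn_gt0 2 z0))).
  rewrite (_ : z ^+ 2 * (1 - _) = z ^+ 2 - t * z); last by field; lra.
  by rewrite lnXn // -mulr_natl; lra.
have lower t : 0 < t -> 2 * ((1 + ln t) * v) - 2 * t * A <= E s (fun b => xlnx (g b ^+ 2)) a.
  move=> t0; apply: le_trans (ler_avg q01 s a (fun b => tangent t (g b) t0)).
  rewrite avgB !avgZ -/v; apply: lerB => //.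
  by apply: ler_wpM2l => //; lra.
move: (v0); rewrite le_eqVlt => /predU1P[v_0|vp].
  rewrite /ent -/v -v_0 /xlnx !mul0r subr0 leNgt; apply/negP => neg.
  (* For [v = 0] the lower bound is [- 2 * t * A]: with this [t] it is half the
     supposedly negative entropy. *)
  have := lower (- E s (fun b => xlnx (g b ^+ 2)) a / (4 * A)).
  rewrite -v_0 divr_gt0; [|lra|lra] => /(_ isT).
  rewrite mulr0 mulr0 (_ : 2 * _ * A = - E s (fun b => xlnx (g b ^+ 2)) a / 2); last by field; lra.
  by rewrite /xlnx; lra.
have := lower (v / A); rewrite divr_gt0 // => /(_ isT).
rewrite /ent -/v [xlnx v]/xlnx.
rewrite (_ : 2 * (v / A) * A = 2 * v); last by field; lra.
rewrite !lnM ?posrE ?invr_gt0 ?exprn_gt0 // !lnV ?posrE ?exprn_gt0 //.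
by rewrite lnXn // -mulr_natl; lra.
Qed.

End LogSobolev.

(** * Sharp thresholds *)

Section Sharp.
Variables (R : realType) (J : eqType).
Implicit Types (a : J -> bool) (f g h : (J -> bool) -> R) (s : seq J).

(** The martingale differences of [f] along the projections that average out
    ever shorter suffixes of [s], from all of [s] down to the empty one. *)
Fixpoint mdiffs (q : R) s f : seq ((J -> bool) -> R) :=
  if s is j :: t then
    (fun a => avg q t f a - avg q (j :: t) f a) :: mdiffs q t f
  else [::].

Section FixedDensity.
Variable q : R.
Hypothesis q01 : 0 <= q <= 1.
Notation E := (avg q).

Lemma size_mdiffs s f : size (mdiffs q s f) = size s.
Proof. by elim: s => //= j s ->. Qed.

Lemma sum_avg1 j T (r : seq T) (F : T -> (J -> bool) -> R) a :
  \sum_(d <- r) avg1 q j (F d) a = avg1 q j (fun b => \sum_(d <- r) F d b) a.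
Proof. by rewrite /avg1 big_split /= -!mulr_sumr. Qed.

(** Martingale differences are orthogonal. *)
Lemma mdiffs_var s f a :
  \sum_(d <- mdiffs q s f) E s (fun b => d b ^+ 2) a =
  E s (fun b => f b ^+ 2) a - E s f a ^+ 2.
Proof.
elim: s a => [|j s IH] a /=; first by rewrite big_nil subrr.
rewrite big_cons sum_avg1.
rewrite [X in _ + avg1 q j X a](_ : _ = fun b => E s (fun c => f c ^+ 2) b - E s f b ^+ 2); last first.
  by apply/funext => b; rewrite IH.
rewrite (@avg_id _ _ q s (fun b => _ ^+ 2)); last first.
  move=> i si b x; congr (_ ^+ 2); congr (_ - _); first exact: ignores_avg_in.
  by apply: ignores_avg1_neq; apply: ignores_avg_in.
rewrite /avg1 !updK; ring.
Qed.

Lemma grad_mdiffs s j f : j \notin s ->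
  map (grad j) (mdiffs q s f) = mdiffs q s (grad j f).
Proof.
elim: s => //= i s IH; rewrite inE negb_or eq_sym => /andP[ij js].
rewrite IH // -grad_avg // -grad_avg1 //; congr cons.
by apply/funext => b; rewrite /grad; ring.
Qed.

(** The derivative in direction [j] commutes with averages over the other
    coordinates and kills functions already averaged over [j].  So the
    derivatives of the martingale differences of [f] are those of
    [grad j f], and the latter are orthogonal. *)
Lemma mdiffs_grad s j f a : uniq s -> j \in s ->
  \sum_(d <- mdiffs q s f) E s (fun b => grad j d b ^+ 2) a =
  E s (fun b => grad j f b ^+ 2) a.
Proof.
elim: s a => //= i s IH a /andP[is_ us].
rewrite inE big_cons sum_avg1 => /orP[/eqP ->|js].
  have -> : grad i (fun a => E s f a - avg1 q i (E s f) a) = E s (grad i f).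
    by rewrite -grad_avg //; apply/funext => b; rewrite /grad /avg1 !updK; ring.
  rewrite (@avg_id _ _ q s (fun b => _ ^+ 2)); last first.
    by move=> l sl b x; congr (_ ^+ 2); apply: ignores_avg_in.
  have -> : (fun b => \sum_(d <- mdiffs q s f) E s (fun b => grad i d b ^+ 2) b) =
      fun b => E s (fun b => grad i f b ^+ 2) b - E s (grad i f) b ^+ 2.
    by apply/funext => b; rewrite -mdiffs_var -grad_mdiffs // big_map.
  by rewrite /avg1; ring.
have ij : i != j by apply: contraNneq is_ => ->.
have -> : grad j (fun a => E s f a - avg1 q i (E s f) a) = fun=> 0.
  apply: grad_ignores => b x; congr (_ - _); first exact: ignores_avg_in.
  by apply: ignores_avg1_neq; apply: ignores_avg_in.
rewrite expr0n /= (@avg_id _ _ q s (fun=> 0)) // avg1_id // add0r.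
by congr (avg1 q i _ a); apply/funext => b; rewrite IH.
Qed.

(** A martingale difference is an average of [f - avg1 q j f], which is
    [grad j f] times [- q] or [1 - q]; this is where small influences make
    the differences small in first moment. *)
Lemma norm_mdiffs s f a j0 t : uniq s -> (t < size s)%N ->
  E s (fun b => `|nth f (mdiffs q s f) t b|) a <=
  E s (fun b => `|grad (nth j0 s t) f b|) a.
Proof.
have [q0 q1] := andP q01.
elim: s t a => //= j s IH [|t] a /andP[js us] ts; last first.
  rewrite /avg1; apply: lerD; apply: ler_wpM2l; rewrite ?subr_ge0 //; exact: IH.
rewrite /=.
apply: (@le_trans _ _ (avg1 q j (E s (E s (fun b => `|grad j f b|))) a)).
  apply: (@ler_avg _ _ q q01 (j :: s)) => b.
  apply: le_trans (ler_norm_avg q01 _ _ _); rewrite -grad_avg //.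
  rewrite /grad /avg1; set F := E s f.
  rewrite -{1}(upd_id b j); case: (b j).
    rewrite (_ : _ - _ = (1 - q) * (F (upd b j true) - F (upd b j false))); last by ring.
    by rewrite normrM ger0_norm ?subr_ge0 // ler_piMl //; lra.
  rewrite (_ : _ - _ = - (q * (F (upd b j true) - F (upd b j false)))); last by ring.
  by rewrite normrN normrM ger0_norm // ler_piMl.
by rewrite avg_idem.
Qed.

(** The log-sum inequality against equal weights: each term is compared with
    the tangent of [x * ln x] at the mean [V / n]. *)
Lemma log_sum_ge (v : nat -> R) (n : nat) (A : R) :
  (0 < n)%N -> (forall t, 0 <= v t) -> 0 < A ->
  let V := \sum_(0 <= t < n) v t in
  0 < V -> V * ln (V / (n%:R * A)) <= \sum_(0 <= t < n) v t * ln (v t / A).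
Proof.
move=> n0 v0 A0 /= V0; set V := \sum_(_ <= _ < _) _ in V0 *.
have nR : 0 < n%:R :> R by rewrite ltr0n.
have [x xE] : exists x, x = V / n%:R by exists (V / n%:R).
have x0 : 0 < x by rewrite xE divr_gt0.
have key y t : 0 < y -> v t - y + v t * ln (y / A) <= v t * ln (v t / A).
  move=> y0; have := v0 t; rewrite le_eqVlt => /predU1P[<-|vt].
    by rewrite !mul0r sub0r addr0 oppr_le0 ltW.
  have vx : 0 < v t / y by rewrite divr_gt0.
  have := ln_ge_1subV vx; rewrite invf_div => /(ler_wpM2l (ltW vt)).
  rewrite (_ : v t * (1 - _) = v t - y); last by field; lra.
  rewrite !lnM ?posrE ?invr_gt0 // !lnV ?posrE //; lra.
apply: le_trans (_ : \sum_(0 <= t < n) (v t - x + v t * ln (x / A)) <= _); last first.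
  by apply: ler_sum => t _; apply: key.
rewrite big_split /= sumrB -mulr_suml -/V sumr_const_nat subn0 -[x *+ n]mulr_natr.
rewrite (_ : x * n%:R = V); last by rewrite xE; field; lra.
rewrite subrr add0r (_ : V / _ = x / A) //.
by rewrite xE; field; apply/andP; split; lra.
Qed.

(** Each martingale difference has first moment at most [A], so
    [ent_sqr_ge] bounds its entropy below, while [log_sobolev] bounds it
    above; the sum over all differences is controlled by [log_sum_ge] on one
    side and by [mdiffs_grad] on the other. *)
Lemma talagrand s f a (A : R) : uniq s -> 0 < A ->
  (forall j, j \in s -> E s (fun b => `|grad j f b|) a <= A) ->
  let V := E s (fun b => f b ^+ 2) a - E s f a ^+ 2 in 0 < V ->
  V * ln (V / ((size s)%:R * A ^+ 2)) <=
  2 * \sum_(j <- s) E s (fun b => grad j f b ^+ 2) a.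
Proof.
move=> us A0 hA /=; rewrite -mdiffs_var (big_nth f) size_mdiffs => V0.
have s0 : (0 < size s)%N.
  by case: s V0 {us hA} => //=; rewrite big_geq // ltxx.
have j0 : J by case: s s0 {us hA V0}.
apply: le_trans (log_sum_ge s0 _ _ V0) _; last 1 first.
- apply: le_trans (_ : \sum_(0 <= t < size s)
    2 * \sum_(j <- s) E s (fun b => grad j (nth f (mdiffs q s f) t) b ^+ 2) a <= _).
    rewrite big_seq [leRHS]big_seq; apply: ler_sum => t; rewrite mem_index_iota /= => ts.
    apply: le_trans (log_sobolev q01 _ _ us).
    apply: ent_sqr_ge => //; apply: le_trans (norm_mdiffs f a j0 us ts) _.
    by apply: hA; apply: mem_nth.
  rewrite -mulr_sumr exchange_big /= ler_wpM2l // big_seq [leRHS]big_seq.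
  apply: ler_sum => j js; rewrite -(mdiffs_grad f a us js).
  by rewrite [leRHS](big_nth f) size_mdiffs.
- by move=> t; apply: avg_ge0 => // b; apply: sqr_ge0.
- by rewrite exprn_gt0.
Qed.

End FixedDensity.

(** The average is affine in the parameter of each coordinate separately, with
    the average of [grad j f] as slope; the chain rule adds these slopes. *)
Lemma russo (q : R) s f a : uniq s ->
  is_derive q (1 : R) (fun q => avg q s f a) (\sum_(j <- s) avg q s (grad j f) a).
Proof.
elim: s a => [|j s IH] a /=; first by rewrite big_nil => _; apply: is_derive_cst.
move=> /andP[js us]; rewrite big_cons sum_avg1.
rewrite -grad_avg // avg1_id; last exact: ignores_grad.
have d1 := IH (upd a j true) us; have d0 := IH (upd a j false) us.
rewrite /avg1.
apply: is_derive_eq.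
rewrite /GRing.scale /= /grad; ring.
Qed.

(** Both claims are the mean value theorem for Russo's formula. *)
Lemma avg_mono s f a p1 p2 : uniq s -> increasing f -> 0 <= p1 -> p1 <= p2 -> p2 <= 1 ->
  avg p1 s f a <= avg p2 s f a /\
  (p1 < p2 -> exists2 q, p1 <= q <= p2 &
    avg p2 s f a - avg p1 s f a = (\sum_(j <- s) avg q s (grad j f) a) * (p2 - p1)).
Proof.
move=> us fi p10 p12 p21.
have D q := russo q f a us.
have mvt : p1 < p2 -> exists2 q, p1 <= q <= p2 &
    avg p2 s f a - avg p1 s f a = (\sum_(j <- s) avg q s (grad j f) a) * (p2 - p1).
  move=> lt12.
  have [|q] := @MVT R (fun q => avg q s f a) (fun q => \sum_(j <- s) avg q s (grad j f) a) _ _ lt12 (fun q _ => D q).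
    by apply: derivable_within_continuous => q _; have [] := D q.
  by rewrite in_itv /= => /andP[/ltW h1 /ltW h2] e; exists q; rewrite ?h1 ?h2.
split=> //; move: p12; rewrite le_eqVlt => /predU1P[->//|lt12].
have [q /andP[h1 h2] e] := mvt lt12.
rewrite -subr_ge0 e; apply: mulr_ge0; last by rewrite subr_ge0 ltW.
apply: sumr_ge0 => j _; apply: avg_ge0; first by apply/andP; split; lra.
by move=> b; rewrite subr_ge0.
Qed.

(** [M] plays the part of the size of the smallest orbit of a symmetry group
    of the event: no influence exceeds a fraction [1 / M] of their sum.  If
    the probability stays in the window from [delta] to [1 - eta] between
    [p1] and [p2], the mean value theorem yields a density where the sum of
    the influences is at most [1 / (p2 - p1)] although the variance is at
    least [delta * eta], and [talagrand] bounds [M]. *)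
Lemma sharp_threshold s f a (M D p1 p2 delta eta : R) :
  uniq s -> increasing f -> (forall b, f b = 0 \/ f b = 1) ->
  0 <= p1 -> p1 < p2 -> p2 <= 1 -> 0 < M -> 0 < D -> (size s)%:R = D * M ->
  (forall q j, 0 <= q <= 1 -> j \in s ->
     M * avg q s (grad j f) a <= \sum_(i <- s) avg q s (grad i f) a) ->
  0 < delta -> 0 < eta ->
  delta <= avg p1 s f a -> avg p2 s f a <= 1 - eta ->
  delta * eta * ln (delta * eta * (p2 - p1) ^+ 2 / D * M) <= 2 / (p2 - p1).
Proof.
move=> us fi f01 p10 p12 p21 M0 D0 sE sym d0 e0 P1 P2.
have [_ /(_ p12)[q /andP[h1 h2] e]] := avg_mono a us fi p10 (ltW p12) p21.
have [lo _] := avg_mono a us fi p10 h1 (le_trans h2 p21).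
have [hi _] := avg_mono a us fi (le_trans p10 h1) h2 p21.
have q01 : 0 <= q <= 1 by apply/andP; split; lra.
have f0 b : 0 <= f b by case: (f01 b) => ->.
have f1 b : f b <= 1 by case: (f01 b) => ->.
have g0 j b : 0 <= grad j f b by rewrite subr_ge0.
have := sym q; set I := \sum_(i <- s) _ in e * => {}sym.
pose C := (p2 - p1)^-1.
have C0 : 0 < C by rewrite invr_gt0 subr_gt0.
have P20 : 0 < p2 - p1 by rewrite subr_gt0.
have IC : I <= C.
  rewrite /C -(ler_pM2r P20) -e mulVf ?gt_eqF //.
  have : avg p2 s f a <= 1 by apply: avg_le1 => //; apply/andP; split; lra.
  have : 0 <= avg p1 s f a by apply: avg_ge0 => //; apply/andP; split; lra.
  by lra.
have A0 : 0 < C / M by rewrite divr_gt0.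
have infl j : j \in s -> avg q s (fun b => `|grad j f b|) a <= C / M.
  move=> js; rewrite (_ : (fun b => _) = grad j f); last first.
    by apply/funext => b; rewrite ger0_norm.
  by rewrite ler_pdivlMr // mulrC; apply: le_trans (sym j q01 js) IC.
have := talagrand q01 us A0 infl.
have -> : (fun b => f b ^+ 2) = f.
  by apply/funext => b; case: (f01 b) => ->; rewrite ?expr0n ?expr1n.
have -> : \sum_(j <- s) avg q s (fun b => grad j f b ^+ 2) a = I.
  apply: eq_bigr => j _; congr (avg _ _ _ a); apply/funext => b.
  have := fi b j; rewrite /grad.
  case: (f01 (upd b j true)) => ->; case: (f01 (upd b j false)) => -> //; first by rewrite subrr expr0n.
  - by rewrite ler10.
  - by rewrite subr0 expr1n.
  by rewrite subrr expr0n.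
set P := avg q s f a; set V := P - P ^+ 2.
have VE : delta * eta <= V.
  rewrite (_ : V = P * (1 - P)); last by rewrite /V; ring.
  by apply: ler_pM; rewrite /P; lra.
have de : 0 < delta * eta by rewrite mulr_gt0.
move=> /(_ (lt_le_trans de VE)).
rewrite sE; set X := D * M * _.
have XE : X^-1 = (p2 - p1) ^+ 2 / D * M.
  by rewrite /X /C; field; apply/and3P; split; lra.
rewrite XE => T.
have Y0 : 0 < (p2 - p1) ^+ 2 / D * M by rewrite !mulr_gt0 ?invr_gt0 ?exprn_gt0.
have -> : delta * eta * (p2 - p1) ^+ 2 / D * M = delta * eta * ((p2 - p1) ^+ 2 / D * M).
  by ring.
move: Y0 T; set Y := _ * M => Y0 T.
apply: le_trans (_ : 2 * I <= _); last by rewrite ler_pM2l.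
have [ln0|ln0] := leP (ln (delta * eta * Y)) 0.
  apply: (@le_trans _ _ 0); first by rewrite mulr_ge0_le0 // ltW.
  rewrite mulr_ge0 // sumr_ge0 // => j _; exact: avg_ge0.
apply: le_trans T; apply: ler_pM => //; [exact: ltW | exact: ltW |].
by rewrite ler_ln ?posrE ?ler_pM2r //; apply: mulr_gt0 => //; exact: lt_le_trans VE.
Qed.

End Sharp.

(** * Events of Bernoulli percolation *)

Section Events.
Variables (R : realType).

Definition determined (J : Type) (P : J -> Prop) (F : set (J -> bool)) :=
  forall a b, (forall j, P j -> a j = b j) -> F a -> F b.

Definition ind (J : Type) (F : set (J -> bool)) : (J -> bool) -> R :=
  fun a => (`[< F a >])%:R.

Lemma ind_ge0 J (F : set (J -> bool)) a : 0 <= ind F a.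
Proof. by rewrite /ind ler0n. Qed.

Lemma indT J (F : set (J -> bool)) a : F a -> ind F a = 1.
Proof. by move=> Fa; rewrite /ind asboolT. Qed.

Lemma indF J (F : set (J -> bool)) a : ~ F a -> ind F a = 0.
Proof. by move=> Fa; rewrite /ind asboolF. Qed.

Lemma ind01 J (F : set (J -> bool)) a : ind F a = 0 \/ ind F a = 1.
Proof. by rewrite /ind; case: asbool; [right|left]. Qed.

Lemma ler_ind J1 J2 (F : set (J1 -> bool)) (G : set (J2 -> bool)) a b :
  (F a -> G b) -> ind F a <= ind G b.
Proof.
move=> FG; have [Fa|Fa] := pselect (F a); first by rewrite !indT //; apply: FG.
by rewrite indF // ind_ge0.
Qed.

Lemma eq_ind_determined J P (F : set (J -> bool)) a b :
  determined P F -> (forall j, P j -> a j = b j) -> ind F a = ind F b.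
Proof.
move=> dF ab; apply/eqP; rewrite eq_le; apply/andP; split.
  by apply: ler_ind; apply: dF.
by apply: ler_ind; apply: dF => j /ab.
Qed.

Lemma ignores_ind (J : eqType) (P : J -> Prop) (F : set (J -> bool)) j :
  determined P F -> ~ P j -> ignores j (ind F).
Proof.
move=> dF Pj a x; apply: eq_ind_determined dF _ => i Pi.
by rewrite /upd; case: eqP => // ij; rewrite ij in Pi.
Qed.

(** Applied both to the symmetries of the torus and to its embeddings as a
    box of the lattice. *)
Lemma avg_reindex (J1 J2 : eqType) (sigma : J1 -> J2) (q : R) s f w :
  injective sigma ->
  avg q (map sigma s) (fun w => f (w \o sigma)) w = avg q s f (w \o sigma).
Proof.
move=> si; elim: s w => //= j s IH w; rewrite /avg1 !IH.
have h x : upd w (sigma j) x \o sigma = upd (w \o sigma) j x.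
  by apply/funext => i; rewrite /upd /= (inj_eq si).
by rewrite !h.
Qed.

Lemma avg_indep_prod (J T : eqType) (q : R) (U : seq T) (S : T -> seq J)
    (F : T -> (J -> bool) -> R) a :
  uniq U ->
  (forall t u j, t \in U -> u \in U -> j \in S t -> t <> u -> ignores j (F u)) ->
  avg q (flatten (map S U)) (fun b => \prod_(t <- U) F t b) a =
  \prod_(t <- U) avg q (S t) (F t) a.
Proof.
elim: U a => [|t U IH] a /=.
  move=> _ _; rewrite big_nil; by rewrite big_nil.
move=> /andP[tU uU] fr; rewrite big_cons -IH //; last first.
  by move=> v u j vU uU'; apply: fr; rewrite inE ?vU ?uU' orbT.
rewrite -avg_indep.
- by congr avg; apply/funext => b; rewrite big_cons.
- move=> j /flattenP[_ /mapP[u uU' ->] ju]; apply: (fr u) => //.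
  + by rewrite inE uU' orbT.
  + by rewrite mem_head.
  by move=> ut; rewrite -ut uU' in tU.
move=> j jt.
have : forall u, u \in U -> ignores j (F u).
  move=> u uU'; apply: (fr t) => //; rewrite ?mem_head // ?inE ?uU' ?orbT //.
  by move=> tu; rewrite tu uU' in tU.
elim: U {IH tU uU fr} => [|u U IH] fr b x; first by rewrite !big_nil.
rewrite !big_cons IH ?fr ?mem_head // => v vU.
by apply: fr; rewrite inE vU orbT.
Qed.

Variables (d : nat) (p : R) (mu : probability (config d) R).
Hypothesis mup : bernoulli_percolation p mu.

Definition cylinder (s : seq (bond d)) (a : bond d -> bool) : set (config d) :=
  [set w | forall b, b \in s -> w b = a b].

Lemma measurable_cylinder s a : measurable (cylinder s a).
Proof.
elim: s => [|j s IH].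
  rewrite (_ : cylinder [::] a = setT); first exact: measurableT.
  by apply/seteqP; split.
have m1 : measurable ([set w | w j = true] : set (config d)).
  by apply: sub_sigma_algebra; exists j.
rewrite (_ : cylinder (j :: s) a = (if a j then [set w | w j = true] else ~` [set w | w j = true]) `&` cylinder s a).
  by apply: measurableI => //; case: ifP => // _; apply: measurableC.
apply/seteqP; split=> w.
  move=> h; split; last by move=> b bs; apply: h; rewrite inE bs orbT.
  by have := h j (mem_head _ _); case: (a j) => // /= ->.
move=> [h1 h2] b; rewrite inE => /predU1P[->|/h2//].
by case: (a j) h1 => //=; case: (w j).
Qed.

(** Split the cylinder according to the states of the bonds of [t], one after
    the other. *)
Lemma mu_cylinder_avg t s a (F : set (config d)) : uniq (s ++ t) ->
  determined (fun b => b \in s ++ t) F ->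
  measurable (cylinder s a `&` F) /\
  mu (cylinder s a `&` F) =
    ((\prod_(b <- s) (if a b then p else 1 - p)) * avg p t (ind F) a)%:E.
Proof.
elim: t s a => [|j t IH] s a us dF.
  rewrite cats0 in us dF; rewrite /=.
  have [Fa|Fa] := pselect (F a).
    rewrite indT // mulr1 (_ : _ `&` _ = cylinder s a).
      by split; [exact: measurable_cylinder | exact: mup].
    apply/seteqP; split=> w; first by case.
    by move=> wa; split=> //; apply: dF Fa => b bs; rewrite wa.
  rewrite indF // mulr0 (_ : _ `&` _ = set0).
    by split; [exact: measurable0 | exact: measure0].
  apply/seteqP; split=> w // -[wa Fw]; apply: Fa; apply: dF Fw => b bs.
  by rewrite wa.
have us' : uniq ((j :: s) ++ t) by rewrite -cat1s -catA uniq_catCA.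
have dF' : determined (fun b => b \in (j :: s) ++ t) F.
  move=> b c bc; apply: dF => i iI; apply: bc.
  by move: iI; rewrite inE !mem_cat inE; case: (i == j); rewrite ?orbT.
have js : j \notin s.
  by move: us'; rewrite /= mem_cat negb_or => /andP[/andP[]].
have [m1 e1] := IH (j :: s) (upd a j true) us' dF'.
have [m0 e0] := IH (j :: s) (upd a j false) us' dF'.
have split_cyl : cylinder s a `&` F = (cylinder (j :: s) (upd a j true) `&` F) `|`
                     (cylinder (j :: s) (upd a j false) `&` F).
  rewrite -setIUl; congr (_ `&` _); apply/seteqP; split=> w.
    move=> wa; case E : (w j); [left|right] => b; rewrite inE /upd;
      by case: eqP => [->//|_ /= /wa].
  case=> h b bs; have := h b; rewrite inE bs orbT => /(_ isT) ->;
  by rewrite /upd; case: eqP bs js => // -> ->.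
have P x : \prod_(b <- j :: s) (if upd a j x b then p else 1 - p) =
    (if x then p else 1 - p) * \prod_(b <- s) (if a b then p else 1 - p).
  rewrite big_cons /upd eqxx; congr (_ * _).
  rewrite big_seq [RHS]big_seq; apply: eq_bigr => b bs.
  by case: eqP bs js => // -> ->.
rewrite split_cyl; split; first exact: measurableU.
rewrite measureU //.
  rewrite P in e1; rewrite P in e0.
  apply: etrans (congr2 adde e1 e0) _; apply: (etrans (esym (EFinD _ _)));  congr EFin; rewrite /= /avg1; ring.
apply/seteqP; split=> w // -[[h1 _] [h0 _]].
have := h1 j (mem_head _ _); have := h0 j (mem_head _ _).
by rewrite /upd eqxx => ->.
Qed.

Lemma mu_avg s a (F : set (config d)) : uniq s ->
  determined (fun b => b \in s) F ->
  measurable F /\ mu F = (avg p s (ind F) a)%:E.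
Proof.
move=> us dF; have := @mu_cylinder_avg s [::] a F us dF.
rewrite big_nil mul1r (_ : cylinder _ _ `&` F = F) //.
by apply/seteqP; split=> w; [case | split].
Qed.

Lemma mu_indep (T : eqType) (U : seq T) (S : T -> seq (bond d))
    (F : T -> set (config d)) (x : R) :
  uniq U -> (forall t, uniq (S t)) ->
  (forall t, determined (fun b => b \in S t) (F t)) ->
  (forall t u b, t \in U -> u \in U -> t <> u -> b \in S t -> b \notin S u) ->
  (forall t, mu (F t) = x%:E) ->
  mu [set w | forall t, t \in U -> F t w] = (x ^+ size U)%:E.
Proof.
move=> uU uS dF disj mx.
pose a : bond d -> bool := fun=> false.
have uf : uniq (flatten (map S U)).
  elim: U uU disj => //= t U IH /andP[tU uU] disj.
  rewrite cat_uniq uS IH //; last first.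
    by move=> v u b vU uU'; apply: disj; rewrite inE ?vU ?uU' orbT.
  rewrite andbT; apply/hasPn => b /flattenP[_ /mapP[u uU' ->] bu].
  apply: (disj u) => //; rewrite ?mem_head // ?inE ?uU' ?orbT //.
  by move=> ut; rewrite -ut uU' in tU.
have dA : determined (fun b => b \in flatten (map S U)) [set w | forall t, t \in U -> F t w].
  move=> b c bc Fb t tU; apply: dF (Fb t tU) => j jt; apply: bc.
  by apply/flattenP; exists (S t) => //; apply: map_f.
have [_ ->] := mu_avg a uf dA; congr EFin.
rewrite (_ : ind _ = fun b => \prod_(t <- U) ind (F t) b); last first.
  apply/funext => b; have [Fb|Fb] := pselect (forall t, t \in U -> F t b).
    rewrite indT // big_seq big1 // => t tU; rewrite indT //; exact: Fb.
  rewrite indF //; apply/esym/eqP; rewrite prodf_seq_eq0; apply/hasP.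
  have /existsNP[t /not_implyP[tU Ft]] := Fb.
  by exists t => //=; rewrite indF.
rewrite avg_indep_prod //; last first.
  move=> t u j tU uU' jt tu; apply: ignores_ind (dF u) _.
  by apply/negP; apply: disj jt.
rewrite (eq_bigr (fun=> x)).
  by rewrite big_const_seq count_predT -[RHS]mulr1 iter_mulr.
by move=> t _; have [_] := mu_avg a (uS t) (dF t); rewrite mx => -[].
Qed.

End Events.

(** * Lattice isometries and filled boxes *)

Section Lattice.
Variables (R : realType) (d : nat).
Implicit Types (x y z v : Zd d) (g : Zd d -> Zd d).

(** A nonnegative integer sum with value 1 has exactly one nonzero term. *)
Lemma sum_sqr_eq1 (u : 'I_d -> int) : \sum_i u i ^+ 2 = 1 ->
  exists j, `|u j| = 1 /\ forall i, i != j -> u i = 0.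
Proof.
move=> u1.
have [j uj] : exists j, u j != 0.
  apply/not_existsP => h; move: u1; rewrite big1 // => i _.
  by have /negP := h i; rewrite negbK => /eqP ->; rewrite expr0n.
move: u1; rewrite (bigD1 j) //=.
set r := \sum_(_ < _ | _) _ => u1.
have r0 : 0 <= r by apply: sumr_ge0 => i _; apply: sqr_ge0.
have uj1 : 1 <= u j ^+ 2.
  by rewrite -gtz0_ge1 lt_neqAle sqr_ge0 eq_sym sqrf_eq0 uj.
have r_0 : r = 0 by lia.
exists j; split.
  have : `|u j| ^+ 2 = 1 by rewrite real_normK ?num_real //; lia.
  by move=> /eqP; rewrite sqrf_eq1 => /orP[/eqP//|/eqP]; have := normr_ge0 (u j); lia.
move=> i ij; apply/eqP; rewrite -sqrf_eq0; move: r_0 => /eqP.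
rewrite /r psumr_eq0; last by move=> l _; apply: sqr_ge0.
by move=> /allP/(_ i); rewrite mem_index_enum ij => /(_ isT).
Qed.

(** An integer orthogonal matrix is a signed permutation matrix. *)
Lemma isometry_coord (B : 'M[int]_d) : B^T *m B = 1%:M -> forall i,
  exists j e, `|e| = 1 /\ forall x, (B^T *m x) i 0 = e * x j 0.
Proof.
move=> BB i.
have : (B^T *m B) i i = 1 by rewrite BB mxE eqxx.
rewrite mxE (eq_bigr (fun j => B j i ^+ 2)); last by move=> j _; rewrite mxE.
move=> /(@sum_sqr_eq1 (fun j => B j i))[j [e1 h]]; exists j, (B j i); split=> // x.
rewrite mxE (bigD1 j) //= big1 ?addr0 ?mxE // => l lj.
by rewrite mxE h // mul0r.
Qed.

(** The columns of the real matrix are images of lattice vectors, hence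
    integral. *)
Lemma Gamma_int g : Gamma R g ->
  exists (B : 'M[int]_d), [/\ B^T *m B = 1%:M, B *m B^T = 1%:M &
    forall x, g x = B *m x + g 0].
Proof.
move=> [A [v [AA _ Aim gE]]].
have ex j : exists w : Zd d, lattice_vec R w = A *m lattice_vec R (delta_mx j 0).
  have : range (@lattice_vec R d) (A *m lattice_vec R (delta_mx j 0)).
    by rewrite -Aim; exists (delta_mx j 0).
  by move=> [w _ <-]; exists w.
have [W WE] := choice ex.
pose B : 'M[int]_d := \matrix_(i, j) W j i 0.
have AB : A = map_mx intr B.
  apply/matrixP => i j; rewrite !mxE.
  have /matrixP/(_ i 0) := WE j; rewrite /lattice_vec !mxE => ->.
  rewrite (bigD1 j) //= big1 ?addr0; last first.
    by move=> l lj; rewrite !mxE (negbTE lj) mulr0.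
  by rewrite !mxE eqxx mulr1.
have inj : injective (@lattice_vec R d).
  by move=> x y /matrixP h; apply/matrixP => i j; have := h i j; rewrite !mxE => /intr_inj.
have BB : B^T *m B = 1%:M.
  apply/matrixP => i j; apply: (@intr_inj R).
  have /matrixP/(_ i j) := AA; rewrite AB map_trmx -map_mxM [in LHS]mxE => ->.
  by rewrite !mxE; case: (i == j).
exists B; split=> //; first exact: mulmx1C.
have g0 : g 0 = v.
  by apply: inj; rewrite gE {1}/lattice_vec map_mx0 mulmx0 add0r.
move=> x; apply: inj; rewrite gE g0 AB /lattice_vec -map_mxM.
by apply/matrixP => i j; rewrite !mxE intrD.
Qed.

Lemma Gamma_box g n x : Gamma R g -> @box d n x -> @box d n (g x - g 0).
Proof.
move=> /Gamma_int[B [_ BB gE]] xn i; rewrite gE addrK.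
have := @isometry_coord B^T; rewrite trmxK => /(_ BB i)[j [e [e1 ->]]].
by rewrite normrM e1 mul1r.
Qed.

Lemma Gamma_box_inv g n z : Gamma R g -> @box d n (z - g 0) ->
  exists2 x, @box d n x & g x = z.
Proof.
move=> /Gamma_int[B [BB B' gE]] zn; exists (B^T *m (z - g 0)).
  move=> i; have [j [e [e1 ->]]] := isometry_coord BB i.
  by rewrite normrM e1 mul1r.
by rewrite gE mulmxA B' mul1mx subrK.
Qed.

Lemma Gamma_translate g v : Gamma R g -> Gamma R (fun x => g x + v).
Proof.
move=> [A [u [AA dA Aim gE]]]; exists A, (u + v); split=> // x.
have -> y z : lattice_vec R (y + z) = lattice_vec R y + lattice_vec R z.
  by apply/matrixP => i j; rewrite !mxE intrD.
rewrite gE -addrA; congr (_ + _).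
by apply/matrixP => i j; rewrite !mxE intrD.
Qed.

Lemma delta_mx_neq0 i : (delta_mx i 0 : Zd d) != 0.
Proof.
by apply/negP => /eqP/matrixP/(_ i 0); rewrite !mxE !eqxx.
Qed.

Lemma Gamma_nn g x y i : Gamma R g -> g y = g x + delta_mx i 0 ->
  edges (nn_graph d) [set x; y].
Proof.
move=> /Gamma_int[B [BB B' gE]]; rewrite gE (gE x) => e.
have {}e : y - x = B^T *m delta_mx i 0.
  rewrite -[LHS]mul1mx -BB -mulmxA; congr (_ *m _); rewrite mulmxBr.
  by move: e; rewrite addrAC => /addIr ->; rewrite addrAC subrr add0r.
have := @isometry_coord B; move=> /(_ BB).
have : exists j, `|B i j| = 1 /\ forall l, l != j -> B i l = 0.
  apply: (@sum_sqr_eq1 (fun j => B i j)).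
  have : (B *m B^T) i i = 1 by rewrite B' mxE eqxx.
  by rewrite mxE => <-; apply: eq_bigr => j _; rewrite mxE.
move=> [j [ej Bj]] _.
have {}e : y - x = B i j *: delta_mx j 0.
  rewrite e; apply/matrixP => l m; rewrite !mxE (bigD1 i) //= big1.
    rewrite !mxE eqxx addr0 !ord1 eqxx andbT mulr1.
    by case: (eqVneq l j) => [->|lj]; rewrite ?mulr1 // mulr0 Bj.
  by move=> i' ii'; rewrite !mxE (negbTE ii') mulr0.
have [s|s] : B i j = 1 \/ B i j = -1.
  by move/eqP: ej; rewrite eqr_norml => /andP[/orP[/eqP|/eqP] -> _]; [left|right].
  exists (x, j) => //; rewrite /bond_edge /=; congr [set _; _].
  by apply/eqP; rewrite eq_sym addrC -subr_eq e s scale1r.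
exists (y, j) => //; rewrite /bond_edge /= setUC; congr [set _; _].
by move/eqP: e; rewrite s scaleN1r subr_eq => /eqP ->; rewrite addrAC addNr add0r.
Qed.

Definition filled (G : graph d) (y : Zd d) (n : int) :=
  forall z i, @box d n (z - y) -> @box d n (z + delta_mx i 0 - y) ->
    edges G [set z; z + delta_mx i 0].

Lemma Gamma_filled g n (S : graph d) : Gamma R g ->
  graph_le (box_graph d n) S -> filled (gimage g S) (g 0) n.
Proof.
move=> Gg [_ eS] z i zn zin.
have [x xn xz] := Gamma_box_inv Gg zn; have [y yn yz] := Gamma_box_inv Gg zin.
exists [set x; y]; last by rewrite image_setU !image_set1 xz yz.
apply: eS; split; last by move=> _ [->|->].
by apply: (@Gamma_nn g _ _ i) => //; rewrite xz.
Qed.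

Lemma adj_sym (G : graph d) x y : adj G x y -> adj G y x.
Proof. by move=> [xy e]; split; [exact/nesym | rewrite setUC]. Qed.

(** Walk from [z] to [y] decreasing one coordinate of the difference at each
    step: the walk stays in the box. *)
Lemma filled_connected (G : graph d) y n z : filled G y n -> @box d n (z - y) ->
  clos_refl_trans _ (adj G) y z.
Proof.
move=> fill.
have [m] := ubnP (\sum_(i < d) absz ((z - y) i 0)%R); elim: m z => // m IH z.
rewrite ltnS => zm zn.
have [->|/eqP zy] := pselect (z = y); first exact: rt_refl.
have [i zi] : exists i : 'I_d, (z - y : Zd d) i 0 != 0.
  apply/not_existsP => h; apply: (negP zy); rewrite -subr_eq0; apply/eqP.
  by apply/matrixP => i j; rewrite ord1 [RHS]mxE; have /negP := h i; rewrite negbK => /eqP.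
have step e z' : `|e| = 1 -> z' = z + e *: delta_mx i 0 ->
    `|(z - y) i 0 + e| + 1 = `|(z - y) i 0| ->
    @box d n (z' - y) /\ clos_refl_trans _ (adj G) y z'.
  move=> e1 z'E dec.
  have z'i : (z' - y) i 0 = (z - y) i 0 + e.
    by rewrite z'E !mxE !eqxx; lia.
  have z'j j : j != i -> (z' - y) j 0 = (z - y) j 0.
    by move=> ji; rewrite z'E !mxE (negbTE ji) /=; lia.
  have bz' : @box d n (z' - y).
    move=> j; case: (eqVneq j i) => [->|ji]; last by rewrite z'j.
    by rewrite z'i; apply: le_trans (zn i); rewrite -dec lerDl.
  split=> //; apply: IH => //; apply: leq_trans zm.
  rewrite (bigD1 i) //= [X in (_ < X)%N](bigD1 i) //= z'i.
  rewrite (eq_bigr (fun j => absz ((z - y) j 0)%R)); last by move=> j /z'j ->.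
  rewrite ltn_add2r; move: dec; move: ((z - y) i 0) => c; clear; lia.
have [zpos|zneg] := ltP 0 ((z - y) i 0).
  have [|||bz' cz'] := @step (-1) (z - delta_mx i 0).
  - by rewrite normrN1.
  - by rewrite scaleN1r.
  - by move: zpos; move: ((z - y) i 0) => c; clear; lia.
  apply: rt_trans cz' _; apply: rt_step; split.
    move=> /eqP; rewrite -subr_eq0 addrAC subrr add0r oppr_eq0.
    by rewrite (negbTE (delta_mx_neq0 i)).
  have := fill (z - delta_mx i 0) i bz'; rewrite subrK; exact.
have [|||bz' cz'] := @step 1 (z + delta_mx i 0).
- by rewrite normr1.
- by rewrite scale1r.
- by move: zneg zi; move: ((z - y) i 0) => c; clear; lia.
apply: rt_trans cz' _; apply: rt_step; apply: adj_sym; split.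
  move=> /eqP; rewrite -subr_eq0 opprD addrA subrr add0r oppr_eq0.
  by rewrite (negbTE (delta_mx_neq0 i)).
exact: fill.
Qed.

End Lattice.

(** * Anchors at a given scale *)

Section Anchors.
Variables (R : realType) (d : nat) (I : Type) (E : I -> enhancement d).
Implicit Types (x y z v : Zd d) (g : Zd d -> Zd d).

Lemma le_linf_dist x y (i : 'I_d) : (absz (x i 0 - y i 0)%R <= linf_dist x y)%N.
Proof. exact: (@leq_bigmax _ (fun i => absz (x i 0 - y i 0)%R)). Qed.

Lemma finite_radius (G : graph d) : finite_set (vert G) -> exists r, is_radius G r.
Proof.
move=> /finite_seqP[s sE].
pose P n := `[< vert G `<=` @box d n%:Z >].
have exP : exists n, P n.
  exists (\max_(x <- s) linf_dist x 0)%N; apply/asboolP => x.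
  rewrite sE /= => xs i.
  have h : (linf_dist x 0 <= \max_(y <- s) linf_dist y 0)%N.
    exact: (leq_bigmax_seq (F := fun y => linf_dist y 0) x xs).
  have := leq_trans (le_linf_dist x 0 i) h; rewrite mxE subr0 => {}h.
  by rewrite -abszE lez_nat.
exists (ex_minn exP); case: ex_minnP => r /asboolP h hm; split=> // n hn.
by apply: hm; apply/asboolP.
Qed.

Hypothesis E0 : forall i, vert (enhS (E i)) 0.

Lemma has_ubound_linf (G : graph d) r : is_radius G r ->
  ubound [set (linf_dist x y)%:R | x in vert G & y in vert G] ((2 * r)%:R : R).
Proof.
move=> [Gr _] _ [x Gx [y Gy <-]]; rewrite ler_nat.
apply/bigmax_leqP => i _; have := Gr x Gx i; have := Gr y Gy i.
by move: (x i 0) (y i 0) => a b; clear; lia.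
Qed.

Lemma scale_radius k i r : scale R E k i -> is_radius (enhS (E i)) r ->
  (2 ^+ k : R) <= 2 * r%:R.
Proof.
move=> /andP[h _] hr; apply: (le_trans h).
have -> : 2 * r%:R = (2 * r)%:R :> R by rewrite natrM.
apply: ge_sup; last exact: has_ubound_linf.
by exists (linf_dist (0 : Zd d) 0)%:R; exists 0 => //; exists 0.
Qed.

Lemma scale_box k i : scale R E k i -> vert (enhS (E i)) `<=` @box d (2 ^ k.+1)%N%:Z.
Proof.
move=> /andP[_ h] x Sx j.
have [r hr] := finite_radius (@enhS_finite _ (E i)).
have {}h : ((linf_dist x 0)%:R : R) < 2 ^+ k.+1.
  apply: le_lt_trans h; apply: ub_le_sup.
    by exists (2 * r)%:R; apply: has_ubound_linf.
  by exists x => //; exists 0.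
move: h; rewrite -natrX ltr_nat => h.
have := leq_ltn_trans (le_linf_dist x 0 j) h; rewrite mxE subr0.
by move: (2 ^ _)%N (x j 0) => a b; clear; lia.
Qed.

(** The radius [r] of an enhancement of scale [k] satisfies
    [2 ^ k <= 2 * r], so rotundity provides a box of radius at least
    [c * 2 ^ k / 2]; it is enough that [4 <= c * 2 ^ h]. *)
Lemma scale_fill : rotund R E -> exists h : nat, forall k i, (h <= k)%N ->
  scale R E k i -> graph_le (box_graph d (2 * 2 ^ (k - h))%N%:Z) (enhS (E i)).
Proof.
move=> [c c0 rot].
have [h hc] : exists h : nat, 4 <= c * 2 ^+ h.
  exists (Num.truncn (4 / c)).+1.
  rewrite mulrC -ler_pdivrMr //; apply: ltW.
  apply: lt_le_trans (truncnS_gt _) _.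
  rewrite -natrX ler_nat; apply: ltnW; exact: ltn_expl.
exists h => k i hk sk.
have [r hr] := finite_radius (@enhS_finite _ (E i)).
have [v e] := rot i r hr.
have rk := scale_radius sk hr.
have le : (2 * 2 ^ (k - h))%N%:Z <= Num.floor (c * r%:R).
  rewrite floor_ge_int.
  have -> : ((2 * 2 ^ (k - h))%N%:Z)%:~R = 2 * 2 ^+ (k - h) :> R.
    by rewrite -pmulrn natrM natrX.
  have kE : 2 ^+ k = 2 ^+ h * 2 ^+ (k - h) :> R by rewrite -exprD subnKC.
  have p0 : 0 < 2 ^+ (k - h) :> R by rewrite exprn_gt0.
  rewrite -(ler_pM2l (x := 2)) //.
  apply: (@le_trans _ _ (c * 2 ^+ k)); last by rewrite mulrCA ler_pM2l.
  rewrite kE !mulrA ler_pM2r //; apply: le_trans hc; lra.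
have bb : @box d (2 * 2 ^ (k - h))%N%:Z `<=` @box d (Num.floor (c * r%:R)).
  by move=> x xb j; apply: le_trans (xb j) le.
split; first by move=> x /bb /v.
by move=> f [fnn fb]; apply: e; split=> // x /fb /bb.
Qed.

Definition anchored k (X : set (Zd d)) : set (config d) :=
  [set w | exists2 z, activated R E (scale R E k) w z & X (z.2 0)].

Lemma anchored_sub k (X Y : set (Zd d)) : X `<=` Y -> anchored k X `<=` anchored k Y.
Proof. by move=> XY w [z az Xz]; exists z => //; apply: XY. Qed.

(** As the origin belongs to [S], all of [S], and a fortiori [T], lies within
    distance [2 ^ k.+1] of it, and isometries preserve this. *)
Lemma anchored_determined k X :
  determined (fun b : bond d => exists2 y, X y & @box d (2 ^ k.+1)%N%:Z (b.1 - y)) (anchored k X).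
Proof.
move=> w w' ww' [[i g] [/= si Gg [_ eT]] /= Xg]; exists (i, g) => //; split=> //=.
split=> // e /= [f Tf <-].
have /eT[b wb be] : (edges (gimage g (enhT (E i)))) (g @` f) by exists f.
exists b => //=; rewrite -ww' //; exists (g 0) => //.
have [x [y [Tx Ty _ fE]]] := @enhT_graph _ (E i) f Tf.
have : (g @` f) b.1 by rewrite -be; left.
move=> [u fu <-]; apply: Gamma_box Gg _.
apply: (scale_box si); apply: (@enhTS _ (E i)).1.
by move: fu; rewrite fE => -[->|->].
Qed.

Lemma anchored_increasing k X (w w' : config d) :
  (forall b, w b -> w' b) -> anchored k X w -> anchored k X w'.
Proof.
move=> ww' [z [sz Gz [_ eT]] Xz]; exists z => //; split=> //; split=> // e /eT[b wb be].
by exists b => //=; apply: ww'.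
Qed.

Definition translate v (b : bond d) : bond d := (b.1 + v, b.2).

Lemma anchored_translate k X v (w : config d) :
  anchored k X (w \o translate v) -> anchored k [set y | X (y - v)] w.
Proof.
move=> [[i g] [/= si Gg [_ eT]] /= Xg].
exists (i, fun x => g x + v); last by rewrite /= addrK.
split=> //=; first exact: Gamma_translate.
split=> // e /= [f Tf <-].
have /eT[b wb be] : (edges (gimage g (enhT (E i)))) (g @` f) by exists f.
exists (translate v b) => //.
rewrite -(image_comp g (fun x => x + v)) -be /bond_edge image_setU !image_set1 /=.
by rewrite addrAC.
Qed.

Lemma anchored_translateE k X v (w : config d) :
  anchored k X (w \o translate v) <-> anchored k [set y | X (y - v)] w.
Proof.
split; first exact: anchored_translate.
move=> h; have : anchored k [set y | X (y - v)] ((w \o translate v) \o translate (- v)).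
  suff -> : (w \o translate v) \o translate (- v) = w by [].
  by apply/funext => -[x i]; rewrite /= /translate /= subrK.
move=> /anchored_translate; apply: anchored_sub => y /=.
by rewrite opprK addrK.
Qed.

End Anchors.

(** * Anchors on the torus *)

Section Torus.
Variables (R : realType) (d : nat) (I : Type) (E : I -> enhancement d).
Hypothesis E0 : forall i, vert (enhS (E i)) 0.
Variables (k m : nat).
Hypothesis m1 : (1 < m)%N.
Implicit Types (x y z v : Zd d).

Notation V := 'cV['Z_m]_d.
Notation J := (V * 'I_d)%type.
Notation anch := (anchored R E k).

(** Reduction modulo [m]; [unwrap] picks the representatives with coordinates
    from [0] to [m - 1]. *)
Definition wrap (x : Zd d) : V := map_mx intr x.
Definition unwrap (u : V) : Zd d := map_mx (fun z : 'Z_m => (val z)%:Z) u.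

Lemma wrapD x y : wrap (x + y) = wrap x + wrap y.
Proof. exact: map_mxD. Qed.

Lemma unwrapK : cancel unwrap wrap.
Proof. by move=> u; apply/matrixP => i j; rewrite !mxE -pmulrn natr_Zp. Qed.

Definition cube0 (t : nat) : set (Zd d) := [set y | forall i, 0 <= y i 0 < t%:Z].

Lemma wrapK x : cube0 m x -> unwrap (wrap x) = x.
Proof.
move=> xm; apply/matrixP => i j; rewrite ord1 !mxE.
have := xm i; case: (x i 0) => // c /= cm.
by rewrite -pmulrn val_Zp_nat // modn_small.
Qed.

Definition periodic (a : J -> bool) : config d := fun b => a (wrap b.1, b.2).

Definition ttranslate (u : V) (j : J) : J := (j.1 + u, j.2).

Lemma ttranslate_inj u : injective (ttranslate u).
Proof. by move=> [x i] [y j] [/addIr -> ->]. Qed.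

Lemma periodic_translate a v : periodic a \o translate v = periodic (a \o ttranslate (wrap v)).
Proof. by apply/funext => b; rewrite /periodic /translate /ttranslate /= wrapD. Qed.

Definition bonds : seq J := enum {: J}.

Lemma bonds_uniq : uniq bonds. Proof. exact: enum_uniq. Qed.
Lemma mem_bonds j : j \in bonds. Proof. by rewrite mem_enum. Qed.

Let closed_bonds : J -> bool := fun=> false.

Lemma avg_ttranslate (q : R) u f : avg q bonds (fun a => f (a \o ttranslate u)) closed_bonds = avg q bonds f closed_bonds.
Proof.
rewrite -(perm_avg q (s := map (ttranslate u) bonds)); last first.
  apply: uniq_perm; rewrite ?(map_inj_uniq (@ttranslate_inj u)) ?bonds_uniq //.
  move=> [x i]; rewrite mem_bonds; apply/mapP; exists (x - u, i); rewrite ?mem_bonds //.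
  by rewrite /ttranslate /= subrK.
by rewrite avg_reindex //; apply: ttranslate_inj.
Qed.

Definition tevent (X : set (Zd d)) : set (J -> bool) := [set a | anch X (periodic a)].

Definition tprob (q : R) X : R := avg q bonds (ind R (tevent X)) closed_bonds.

Lemma tevent_translate X v a :
  tevent [set y | X (y - v)] a <-> tevent X (a \o ttranslate (wrap v)).
Proof. by rewrite /tevent /= -periodic_translate anchored_translateE. Qed.

Lemma ind_iff (T : Type) (F G : set (T -> bool)) a b :
  (F a <-> G b) -> ind R F a = ind R G b.
Proof. by move=> FG; rewrite /ind; congr (nat_of_bool _)%:R; apply: asbool_equiv_eq. Qed.

Lemma tprob_translate q X v : tprob q [set y | X (y - v)] = tprob q X.
Proof.
rewrite /tprob -[RHS](avg_ttranslate q (wrap v)); congr (avg _ _ _ closed_bonds).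
by apply/funext => a; apply: ind_iff; exact: tevent_translate.
Qed.

Lemma tprob_sub q (X Y : set (Zd d)) : 0 <= q <= 1 -> X `<=` Y -> tprob q X <= tprob q Y.
Proof.
by move=> q01 XY; apply: ler_avg => // a; apply: ler_ind; apply: anchored_sub.
Qed.

Notation D := (2 ^ k.+1)%N.

(** Windows start at [v - 2 ^ k.+1] in each coordinate, so as to contain the
    bonds on which an anchor near [v] depends. *)
Definition window_corner v : Zd d := v - const_mx D%:Z.

Definition place v (j : J) : bond d := (unwrap j.1 + window_corner v, j.2).

Lemma place_inj v : injective (place v).
Proof. by move=> [x i] [y j] [/addIr /(can_inj unwrapK) -> ->]. Qed.

Definition window v : seq (bond d) := map (place v) bonds.

Lemma window_uniq v : uniq (window v).
Proof. by rewrite map_inj_uniq ?bonds_uniq //; apply: place_inj. Qed.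

Lemma mem_window v (b : bond d) : cube0 m (b.1 - window_corner v) -> b \in window v.
Proof.
case: b => x i /= xm; apply/mapP; exists (wrap (x - window_corner v), i); first exact: mem_bonds.
by rewrite /place /= wrapK // subrK.
Qed.

Lemma windowP v (b : bond d) : b \in window v -> cube0 m (b.1 - window_corner v).
Proof.
move=> /mapP[[u i] _ ->] /= j; rewrite addrK mxE /=.
rewrite ltz_nat; apply: leq_trans (ltn_ord (u j 0)) _.
by rewrite (Zp_cast m1).
Qed.

Lemma anchored_window v t (X : set (Zd d)) : (t + 2 * D <= m)%N ->
  X `<=` [set y | cube0 t (y - v)] ->
  determined (fun b => b \in window v) (anch X).
Proof.
move=> tm Xv a b ab; apply: anchored_determined => // -[x i] [y /Xv /= yv xy].
apply: ab; apply: mem_window => j /=.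
have := yv j; have := xy j; rewrite !mxE; move: (x j 0) (y j 0) (v j 0) tm.
by move: D => D' a1 b1 c1; clear; lia.
Qed.

(** In a window of side [m] the periodic extension of a configuration of the
    torus is an honest percolation configuration, and anchors in [X] depend
    on such a window only. *)
Lemma mu_anchored (p : R) (mu : probability (config d) R) v t (X : set (Zd d)) :
  bernoulli_percolation p mu -> (t + 2 * D <= m)%N ->
  X `<=` [set y | cube0 t (y - v)] ->
  measurable (anch X) /\ mu (anch X) = (tprob p X)%:E.
Proof.
move=> mup tm Xv.
have dX := anchored_window tm Xv.
have [mX ->] := mu_avg mup (fun=> false) (window_uniq v) dX; split=> //; congr EFin.
(* Translate the window to the fundamental box, where wrapping is injective. *)
rewrite -(tprob_translate p X (- window_corner v)) /tprob.
rewrite -[RHS](@avg_reindex R _ _ (place v) p bonds (ind R (tevent _)) (fun=> false) (@place_inj v)).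
congr (avg _ _ _ _); apply/funext => w; apply: ind_iff.
rewrite -anchored_translateE.
have agree b : b \in window v -> w b = (periodic (w \o place v) \o translate (- window_corner v)) b.
  case: b => x i /windowP /= xm.
  by rewrite /periodic /translate /place /= wrapK // subrK.
by split; apply: dX => b bw; rewrite agree.
Qed.

Variables (n s : nat).
Hypothesis mE : m = (n * s)%N.
Hypothesis s0 : (0 < s)%N.

(** The torus has side [n * s], so the cubes of side [s] at the points of
    [s Z^d] cover it with [n ^ d] translates. *)
Lemma tevent_cover a : tevent setT a ->
  exists j : {ffun 'I_d -> 'I_n},
    tevent [set y | cube0 s (y - \col_i (s * j i)%N%:Z)] a.
Proof.
move=> [[i g] az _]; set y := g 0.
have m0 : m%:Z != 0 by lia.
pose r l := absz ((y l 0)%R %% m%:Z)%Z.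
have rE l : (r l)%:Z = ((y l 0)%R %% m%:Z)%Z by rewrite gez0_abs // modz_ge0.
have rm l : (r l < m)%N.
  by rewrite -ltz_nat rE; apply: ltz_pmod; lia.
have jlt l : (r l %/ s < n)%N by rewrite ltn_divLR // -mE.
exists [ffun l => Ordinal (jlt l)].
(* Subtracting [z], a multiple of [m], brings the anchor back to the
   fundamental box. *)
pose z : Zd d := \col_l (((y l 0)%R %/ m%:Z)%Z * m%:Z).
have zp : wrap z = 0.
  apply/matrixP => l l'; rewrite !mxE intrM mulrC -pmulrn.
  by rewrite (_ : m%:R = 0 :> 'Z_m) ?mul0r //; apply/val_inj; rewrite /= val_Zp_nat // modnn.
have hz : tevent [set x | cube0 s (x - z - \col_l0 (s * [ffun l => Ordinal (jlt l)] l0)%N%:Z)] a.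
  exists (i, g) => //= l; rewrite !mxE ffunE /= -/y.
  have -> : y l 0 - ((y l 0)%R %/ m%:Z)%Z * m%:Z = (r l)%:Z.
    by rewrite rE; have := divz_eq (y l 0) m%:Z; lia.
  have := divn_eq (r l) s; have := ltn_pmod (r l) s0.
  rewrite mulnC; move: (s * (r l %/ s))%N (r l %% s)%N => e b1 b1s {1 2}->.
  by clear -b1s; lia.
have /(tevent_translate [set x | cube0 s (x - \col_l0 (s * [ffun l => Ordinal (jlt l)] l0)%N%:Z)] z) := hz.
rewrite zp (_ : a \o ttranslate 0 = a) //.
by apply/funext => -[x l]; rewrite /ttranslate /= addr0.
Qed.

(** If the cubes have no anchor, neither has the torus, and by Harris'
    inequality this is at least as likely as for independent cubes. *)
Lemma tprob_cover q : 0 <= q <= 1 ->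
  (1 - tprob q (cube0 s)) ^+ (n ^ d) <= 1 - tprob q setT.
Proof.
move=> q01.
pose C (j : {ffun 'I_d -> 'I_n}) : set (Zd d) := [set y | cube0 s (y - \col_i (s * j i)%N%:Z)].
pose F j (a : J -> bool) : R := 1 - ind R (tevent (C j)) a.
have avgF j : avg q bonds (F j) closed_bonds = 1 - tprob q (cube0 s).
  by rewrite /F (@avgB _ _ q bonds (fun=> 1)) avg_cst -(tprob_translate q (cube0 s) (\col_i (s * j i)%N%:Z)).
have -> : (1 - tprob q (cube0 s)) ^+ (n ^ d) = \prod_j avg q bonds (F j) closed_bonds.
  rewrite (eq_bigr (fun=> 1 - tprob q (cube0 s))) ?prodr_const //.
  by rewrite card_ffun !card_ord.
apply: (@le_trans _ _ (avg q bonds (fun b => \prod_j F j b) closed_bonds)).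
  apply: harris_prod => //.
    by move=> j a; rewrite /F subr_ge0; case: (ind01 R (tevent (C j)) a) => ->.
  move=> j a b; rewrite /F lerB //; apply: ler_ind; apply: anchored_increasing.
  by move=> [x i]; rewrite /periodic /upd /=; case: eqP.
have -> : 1 - tprob q setT = avg q bonds (fun a => 1 - ind R (tevent setT) a) closed_bonds.
  by rewrite /tprob (@avgB _ _ q bonds (fun=> 1)) avg_cst.
apply: ler_avg => // a.
have [Ta|Ta] := pselect (tevent setT a).
  rewrite (indT _ Ta) subrr; have [j Cj] := tevent_cover Ta.
  by rewrite (bigD1 j) //= /F (indT _ Cj) subrr mul0r.
rewrite (indF _ Ta) subr0; apply: prodr_ile1 => j _; rewrite /F.
by case: (ind01 R (tevent (C j)) a) => ->; rewrite ?subr0 ?subrr ?ler01 ?lexx.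
Qed.

End Torus.

(** * Density of anchors above the threshold *)

Section TorusSharp.
Variables (R : realType) (d : nat) (I : Type) (E : I -> enhancement d).
Hypothesis E0 : forall i, vert (enhS (E i)) 0.
Variables (k m : nat).
Hypothesis m1 : (1 < m)%N.
Hypothesis d0 : (0 < d)%N.

Notation V := 'cV['Z_m]_d.
Notation J := (V * 'I_d)%type.

Let closed_bonds : J -> bool := fun=> false.

(** The translates of a bond of the torus all have the same influence, so this
    influence is at most the total one divided by their number. *)
Lemma influence_sym (q : R) (j : J) : 0 <= q <= 1 ->
  (#|{: V}|)%:R * avg q (bonds d m) (grad j (ind R (tevent R E k (m := m) setT))) closed_bonds <=
  \sum_(i <- bonds d m) avg q (bonds d m) (grad i (ind R (tevent R E k (m := m) setT))) closed_bonds.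
Proof.
move=> q01; set f := ind R _; case: j => x l.
have finv u : (fun a => f (a \o ttranslate u)) = f.
  apply/funext => a; apply: ind_iff.
  rewrite -(unwrapK u) -tevent_translate.
  by split; apply: anchored_sub.
have infl u : avg q (bonds d m) (grad (x + u, l) f) closed_bonds = avg q (bonds d m) (grad (x, l) f) closed_bonds.
  rewrite -[RHS](avg_ttranslate q u); congr (avg _ _ _ closed_bonds); apply/funext => a.
  rewrite -{1}(finv u) /grad.
  have h y : upd a (x + u, l) y \o ttranslate u = upd (a \o ttranslate u) (x, l) y.
    apply/funext => j; rewrite /upd /=.
    by rewrite -[(x + u, l)]/(ttranslate u (x, l)) (inj_eq (@ttranslate_inj _ _ u)).
  by rewrite !h.
have pos i : 0 <= avg q (bonds d m) (grad i f) closed_bonds.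
  apply: avg_ge0 => // b; rewrite subr_ge0; apply: ler_ind; apply: anchored_increasing.
  by move=> [y i']; rewrite /periodic /upd /=; case: eqP.
rewrite /bonds big_enum /= -(pair_bigA _ (fun x l => avg q (enum {: J}) (grad (x, l) f) closed_bonds)) /=.
rewrite mulr_natl -sumr_const; apply: ler_sum => y _.
rewrite (bigD1 l) //= -[leLHS]addr0; apply: lerD.
  by rewrite -(infl (y - x)) addrC subrK.
by apply: sumr_ge0 => i _; apply: pos.
Qed.

(** The bound of [sharp_threshold] solved for the side of the torus, with the
    number of vertices as [M] and that of bond directions as [D]. *)
Lemma tprob_sharp (p1 p2 delta eta : R) :
  0 <= p1 -> p1 < p2 -> p2 <= 1 -> 0 < delta -> 0 < eta ->
  delta <= tprob E k m p1 setT -> tprob E k m p2 setT <= 1 - eta ->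
  (m%:R : R) <= expR (2 / (p2 - p1) / (delta * eta)) / (delta * eta * (p2 - p1) ^+ 2 / d%:R).
Proof.
move=> p10 p12 p21 de0 e0 h1 h2.
have M0 : 0 < (#|{: V}|)%:R :> R.
  by rewrite ltr0n; apply/card_gt0P; exists 0.
have D0 : 0 < d%:R :> R by rewrite ltr0n.
have sz : (size (bonds d m))%:R = d%:R * (#|{: V}|)%:R :> R.
  by rewrite /bonds -cardE card_prod card_ord -natrM mulnC.
have incr : increasing (ind R (tevent R E k (m := m) setT)).
  move=> a j; apply: ler_ind; apply: anchored_increasing.
  by move=> [y i']; rewrite /periodic /upd /=; case: eqP.
have := sharp_threshold (bonds_uniq d m) incr (ind01 R _) p10 p12 p21 M0 D0 sz
  (fun q j q01 _ => influence_sym j q01) de0 e0 h1 h2.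
have de : 0 < delta * eta by rewrite mulr_gt0.
have P0 : 0 < p2 - p1 by rewrite subr_gt0.
set Y := delta * eta * (p2 - p1) ^+ 2 / d%:R.
have Y0 : 0 < Y by rewrite !mulr_gt0 ?invr_gt0 ?exprn_gt0.
set C := 2 / _; move=> lnle.
have : ln (Y * (#|{: V}|)%:R) <= C / (delta * eta) by rewrite ler_pdivlMr // mulrC.
have YM0 : 0 < Y * (#|{: V}|)%:R by rewrite mulr_gt0.
rewrite -ler_expR lnK ?posrE // => h.
rewrite ler_pdivlMr // mulrC; apply: le_trans h.
rewrite ler_pM2l // ler_nat card_mx muln1 card_ord (Zp_cast m1).
by rewrite -[X in (X <= _)%N]expn1 leq_exp2l.
Qed.

End TorusSharp.

Section Scales.
Variables (R : realType) (d : nat) (I : Type) (E : I -> enhancement d).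
Hypothesis E0 : forall i, vert (enhS (E i)) 0.
Hypothesis d0 : (0 < d)%N.

(** Among the infinitely many scales where anchors are not rare at [p1],
    those beyond the bound of [tprob_sharp] have their torus event very likely
    at [p2]; the exponent in [eta'] is the number of cubes in
    [tprob_cover]. *)
Lemma dense_anchors (mu : probability (config d) R) (p1 p2 delta eta : R) (h : nat) :
  bernoulli_percolation p1 mu ->
  0 <= p1 -> p1 < p2 -> p2 <= 1 -> 0 < delta -> 0 < eta ->
  (forall n, exists2 k, (n <= k)%N & (delta%:E <= mu (anchor_event R E k))%E) ->
  exists2 k, (h <= k)%N &
    1 - tprob E k (2 ^ (k + 3))%N p2 (cube0 (2 ^ (k - h))%N) <= eta.
Proof.
move=> mup p10 p12 p21 de0 e0 often.
pose eta' := eta ^+ ((2 ^ (h + 3)) ^ d)%N.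
have e'0 : 0 < eta' by rewrite exprn_gt0.
pose B := expR (2 / (p2 - p1) / (delta * eta')) / (delta * eta' * (p2 - p1) ^+ 2 / d%:R).
have [k kn Gk] := often (h + (Num.truncn B).+1)%N.
have hk : (h <= k)%N by lia.
exists k => //.
have p1_01 : 0 <= p1 <= 1 by rewrite p10 /= ltW // (lt_le_trans p12).
have p2_01 : 0 <= p2 <= 1 by rewrite p21 andbT ltW // (le_lt_trans p10).
set m := (2 ^ (k + 3))%N.
have mk : m = (8 * 2 ^ k)%N by rewrite /m expnD mulnC.
have k0 : (0 < 2 ^ k)%N by rewrite expn_gt0.
have m1 : (1 < m)%N by rewrite mk; lia.
have Gk' : delta <= tprob E k m p1 setT.
  pose v : Zd d := const_mx (- (2 ^ k)%N%:Z).
  have Ht : ((2 * 2 ^ k).+1 + 2 * 2 ^ k.+1 <= m)%N by rewrite mk expnS; lia.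
  have HX : @box d (2 ^ k)%N%:Z `<=` [set y | cube0 (2 * 2 ^ k).+1 (y - v)].
    move=> y yb i; have := yb i; rewrite !mxE; move: (2 ^ k)%N (y i 0) => b a.
    by clear; lia.
  have [_ GE] := mu_anchored E0 m1 mup Ht HX.
  move: Gk; rewrite -[anchor_event R E k]/(anchored R E k (@box d (2 ^ k)%N%:Z)) GE lee_fin.
  by move=> /le_trans; apply; apply: tprob_sub.
have Bm : B < m%:R.
  apply: lt_le_trans (truncnS_gt _) _; rewrite ler_nat mk.
  apply: leq_trans (leq_trans (leq_addl h _) kn) _.
  by apply: leq_trans (ltnW (ltn_expl k (isT : (1 < 2)%N))) _; rewrite leq_pmull.
have T2 : 1 - tprob E k m p2 setT < eta'.
  rewrite ltrBlDr -ltrBlDl ltNge; apply/negP => le2.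
  have := tprob_sharp m1 d0 p10 p12 p21 de0 e'0 Gk' le2.
  by rewrite leNgt Bm.
have mE : m = (2 ^ (h + 3) * 2 ^ (k - h))%N.
  by rewrite -expnD /m; congr expn; lia.
have s0 : (0 < 2 ^ (k - h))%N by rewrite expn_gt0.
have := tprob_cover E k m1 mE s0 p2_01.
move=> /le_lt_trans/(_ T2); rewrite /eta' leNgt => lt.
apply/negP => gt; move: lt; apply/negP; rewrite -leNgt.
by apply: lerXn2r; rewrite ?nnegrE ?ltW // (lt_trans e0).
Qed.

End Scales.

(** * Boundaries of finite clusters in the quarter plane *)

Section Peierls.

Definition site := (nat * nat)%type.
Definition within1 (m n : nat) := (m <= n.+1)%N && (n <= m.+1)%N.
Definition king_adj (u v : site) := within1 u.1 v.1 && within1 u.2 v.2.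
Definition grid_adj (u v : site) :=
  ((u.1 == v.1) && ((u.2 == v.2.+1) || (v.2 == u.2.+1))) ||
  ((u.2 == v.2) && ((u.1 == v.1.+1) || (v.1 == u.1.+1))).

Inductive cluster (G : set site) (u : site) : site -> Prop :=
| cluster_root : G u -> cluster G u u
| cluster_step v w : cluster G u v -> grid_adj v w -> G w -> cluster G u w.

Lemma cluster_sub G u v : cluster G u v -> G v.
Proof. by case. Qed.

(** Let [C] be the cluster of the origin, [(k, 0)] the point of the axis that
    follows the last one in [C], and [K] the set of points reached from
    [(k, 0)] by king moves outside [G].  Suppose that [K] misses the other
    axis.  Let [e] be the indicator of the edges from [C] to [K].  It is a
    cocycle modulo 2: around a unit square that meets [K], all the edges
    leaving [C] lead to [K], so [e] is the coboundary of [C] there.  Let [f]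
    be its primitive that vanishes on the axis missed by [K].  Then [f] is
    constant on [C] and jumps at [(k, 0)]; as [C] lies in a large square,
    following the two sides opposite to the axes of a still larger one gives
    two distinct values of [f] at the corner where they meet. *)
Lemma boundary_path (G : set site) (N : nat) : G (0, 0)%N ->
  (forall v, cluster G (0, 0)%N v -> (v.1 <= N)%N /\ (v.2 <= N)%N) ->
  exists k p, [/\ path king_adj (k, 0)%N p,
    forall v, v \in (k, 0)%N :: p -> ~ G v & (last (k, 0)%N p).1 = 0%N].
Proof.
move=> G0 bounded.
pose c v := `[< cluster G (0, 0)%N v >].
have cP v : reflect (cluster G (0, 0)%N v) (c v) by exact: asboolP.
have c0 : c (0, 0)%N by apply/cP/cluster_root.
have [k0 ck0 k0max] : exists2 k, c (k, 0)%N & forall j, c (j, 0)%N -> (j <= k)%N.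
  have exk : exists k, c (k, 0)%N by exists 0%N.
  have bnd k : c (k, 0)%N -> (k <= N)%N by move=> /cP/bounded[].
  by case: (ex_maxnP exk bnd) => k; exists k.
pose k := k0.+1.
pose chain v p := [/\ path king_adj (k, 0)%N p, last (k, 0)%N p = v &
  forall v, v \in (k, 0)%N :: p -> ~ G v].
pose K v := `[< exists p, chain v p >].
have KP v : reflect (exists p, chain v p) (K v) by exact: asboolP.
have outside u v : grid_adj u v -> c u -> ~~ c v -> ~ G v.
  by move=> uv /cP cu /cP cv Gv; apply: cv; apply: cluster_step cu uv Gv.
have KS u v : K u -> king_adj u v -> ~ G v -> K v.
  move=> /KP[p [pp lp Gp]] uv Gv; apply/KP; exists (rcons p v); split.
  - by rewrite rcons_path pp lp.
  - by rewrite last_rcons.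
  move=> w; rewrite -rcons_cons mem_rcons inE => /predU1P[->//|]; exact: Gp.
have Kc u : K u -> ~~ c u.
  move=> /KP[p [_ <- Gp]]; apply/cP => /cluster_sub; apply: Gp; exact: mem_last.
apply: contrapT => none.
have K0 y : ~~ K (0, y)%N.
  by apply/KP => -[p [h1 h2 h3]]; apply: none; exists k, p; split=> //; rewrite h2.
(* The edges between the cluster and [K], as a cochain modulo 2. *)
pose e u v := (c u && K v) || (c v && K u).
have eE u v w : grid_adj u v -> king_adj w u -> king_adj w v -> K w -> e u v = c u (+) c v.
  move=> uv wu wv Kw; rewrite /e.
  have vu : grid_adj v u by move: uv; rewrite /grid_adj; lia.
  have := outside u v uv; have := outside v u vu; have := Kc u; have := Kc v.
  have := KS w u Kw wu; have := KS w v Kw wv.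
  case: (c u); case: (c v) => /=; case: (K u); case: (K v) => //=; intuition.
have square x y : e (x, y) (x.+1, y) (+) e (x.+1, y) (x.+1, y.+1) (+)
    e (x, y.+1) (x.+1, y.+1) (+) e (x, y) (x, y.+1) = false.
  have [|] := boolP [|| K (x, y), K (x.+1, y), K (x.+1, y.+1) | K (x, y.+1)].
    move=> /or4P[] Kw; rewrite !(eE _ _ _ _ _ _ Kw) /king_adj /grid_adj /within1 /=; try lia;
    by case: (c _); case: (c _); case: (c _); case: (c _).
  move=> /norP[/negbTE h1 /norP[/negbTE h2 /norP[/negbTE h3 /negbTE h4]]].
  by rewrite /e h1 h2 h3 h4 !andbF.
(* The primitive of [e] that vanishes on the axis [x = 0]. *)
pose f := fix f (x y : nat) : bool :=
  if x is x'.+1 then f x' y (+) e (x', y) (x, y) else false.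
have fv x y : f x y (+) f x y.+1 = e (x, y) (x, y.+1).
  elim: x => [|x IH] /=; first by rewrite /e !(negbTE (K0 _)) !andbF.
  move: (square x y) IH.
  case: (f x y); case: (f x y.+1); case: (e _ _); case: (e _ _); case: (e _ _);
  by case: (e _ _).
have fh x y : f x y (+) f x.+1 y = e (x, y) (x.+1, y) by rewrite /= addKb.
have fC v : cluster G (0, 0)%N v -> f v.1 v.2 = false.
  elim=> [//|[x1 y1] [x2 y2] c1 IH uv G2].
  have c2 := cluster_step c1 uv G2.
  have e0 : e (x1, y1) (x2, y2) = false.
    have /negbTE K1 : ~~ K (x1, y1) by apply/negP => /Kc /cP.
    have /negbTE K2 : ~~ K (x2, y2) by apply/negP => /Kc /cP.
    by rewrite /e K1 K2 !andbF.
  have e0' : e (x2, y2) (x1, y1) = false by rewrite -e0 /e orbC.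
  move: IH; rewrite /=; case/orP: uv => /= /andP[/eqP ? /orP[]/eqP ?]; subst => IH.
  - by have := fv x2 y2; rewrite e0' IH addbF.
  - by have := fv x2 y1; rewrite e0 IH addFb.
  - by have := fh x2 y2; rewrite e0' IH addbF.
  by have := fh x1 y2; rewrite e0 IH addFb.
have fk j : f (k + j)%N 0%N = true.
  elim: j => [|j IH].
    rewrite addn0 /k /= (fC (k0, 0)%N) ?addFb; last exact/cP.
    rewrite /e ck0 /=; apply/orP; left; apply/KP; exists [::]; split=> // v.
    rewrite inE => /eqP ->; apply: (outside (k0, 0)%N) => //.
      by rewrite /grid_adj /=; lia.
    by apply/negP => /k0max; rewrite /k ltnn.
  have out i : (0 < i)%N -> c (k0 + i, 0)%N = false.
    by move=> i0; apply/negbTE/negP => /k0max; lia.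
  have := fh (k + j)%N 0%N; rewrite IH addnS.
  rewrite /e /k addSnnS out // -addnS out //=.
  by case: (f _ _).
have far x y : (N < x)%N || (N < y)%N -> c (x, y) = false.
  by move=> h; apply/negbTE/negP => /cP/bounded /=; lia.
have col y : f (k + N)%N y = true.
  elim: y => [|y IH]; first exact: fk.
  have kN z : c ((k + N)%N, z) = false by apply: far; rewrite /k; lia.
  by have := fv (k + N)%N y; rewrite IH /e !kN addTb => /negbFE.
have row x : f x N.+1 = false.
  have rN z : c (z, N.+1) = false by apply: far; lia.
  by elim: x => //= x ->; rewrite /e !rN.
by have := col N.+1; rewrite row.
Qed.

End Peierls.

(** * Percolation of rarely bad cells *)

(** Declare the square of side [n] good as well.  A boundary path for the
    cluster of the origin would avoid this square, hence start from some
    [(k, 0)] with [n < k]; so this cluster is unbounded.  Outside the square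
    it is covered by the clusters of the finitely many good points next to
    the square. *)
Lemma unbounded_cluster (good : set site) (n : nat) :
  (forall k p, (n < k)%N -> path king_adj (k, 0)%N p -> (last (k, 0)%N p).1 = 0%N ->
     exists2 v, v \in (k, 0)%N :: p & good v) ->
  exists u, forall N, exists2 v, cluster good u v & (N < v.1)%N || (N < v.2)%N.
Proof.
move=> no_path.
pose inner (v : site) := (v.1 <= n)%N && (v.2 <= n)%N.
pose G : set site := [set v | inner v \/ good v].
apply: contrapT => /forallNP bounded.
have /choice[M MP] u : exists N, forall v, cluster good u v -> (v.1 <= N)%N && (v.2 <= N)%N.
  have /existsNP[N hN] := bounded u; exists N => v uv.
  by rewrite (leqNgt v.1) (leqNgt v.2) -negb_or; apply/negP => Nv; apply: hN; exists v.
pose B := (n + \max_(i < n.+2) \max_(j < n.+2) M (val i, val j))%N.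
have G0 : G (0, 0)%N by left.
have Gv v : cluster G (0, 0)%N v -> inner v \/
    exists2 u : site, (u.1 <= n.+1)%N && (u.2 <= n.+1)%N & cluster good u v.
  elim=> [_|u w _ IH uw Gw]; first by left.
  have [iw|gw] : inner w \/ good w by []; first by left.
  right; case: IH => [iu|[u' u'n u'u]].
    exists w; last exact: cluster_root.
    by move: iu uw; rewrite /inner /grid_adj; lia.
  by exists u' => //; apply: cluster_step uw gw.
have bnd v : cluster G (0, 0)%N v -> (v.1 <= B)%N /\ (v.2 <= B)%N.
  move=> /Gv[|[[u1 u2] /andP[un1 un2] /MP/andP[v1 v2]]].
    by rewrite /inner /B => /andP[h1 h2]; split; apply: leq_trans (leq_addr _ _).
  suff : (M (u1, u2) <= B)%N by move=> h; split; apply: leq_trans h.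
  apply: leq_trans (leq_addl _ _).
  apply: (bigop.bigmax_sup (Ordinal (un1 : (u1 < n.+2)%N))) => //.
  exact: (bigop.bigmax_sup (Ordinal (un2 : (u2 < n.+2)%N))).
have [k [p [pp bad lp]]] := boundary_path G0 bnd.
have nk : (n < k)%N.
  rewrite ltnNge; apply/negP => kn; apply: (bad (k, 0)%N); first exact: mem_head.
  by left; rewrite /inner /= kn.
have [v vp gv] := no_path k p nk pp lp.
by apply: (bad v vp); right.
Qed.

Definition neighbours (u : site) : seq site :=
  [seq (x, y) | x <- [:: u.1.-1; u.1; u.1.+1], y <- [:: u.2.-1; u.2; u.2.+1]].

Fixpoint king_paths (k : nat) (u : site) : seq (seq site) :=
  if k is k'.+1 then
    flatten [seq [seq v :: q | q <- king_paths k' v] | v <- neighbours u]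
  else [:: [::]].

Lemma size_king_paths k u : size (king_paths k u) = (9 ^ k)%N.
Proof.
elim: k u => //= k IH u.
by rewrite !size_cat !size_map !IH expnS /=; lia.
Qed.

Lemma mem_king_paths u q : path king_adj u q -> q \in king_paths (size q) u.
Proof.
elim: q u => //= v q IH u /andP[uv /IH qv].
rewrite -[_ ++ _]/(flatten [seq [seq v :: q | q <- king_paths (size q) v] | v <- neighbours u]).
apply/flattenP; exists [seq v :: q | q <- king_paths (size q) v].
  apply/mapP; exists v => //; apply/allpairsP; exists v; rewrite -surjective_pairing.
  move: uv; rewrite /king_adj /within1 => /andP[/andP[h1 h2] /andP[h3 h4]].
  by split; rewrite // !inE; [move: (u.1) (v.1) h1 h2 | move: (u.2) (v.2) h3 h4];
    clear => a b; lia.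
exact: map_f.
Qed.

Lemma king_path_dist u p : path king_adj u p -> (u.1 <= (last u p).1 + size p)%N.
Proof.
elim: p u => [|v p IH] u /=; first by rewrite addn0.
by move=> /andP[/andP[/andP[h1 _] _] /IH]; rewrite addnS => h; lia.
Qed.

Lemma simple_king_path k p : path king_adj (k, 0)%N p -> (last (k, 0)%N p).1 = 0%N ->
  exists2 q, q \in king_paths k (k, 0)%N &
    uniq ((k, 0)%N :: q) /\ size q = k /\ {subset q <= p}.
Proof.
move=> pp lp0; have := lp0; case: (shortenP pp) => p' pp' up' sub lp'.
have sk : (k <= size p')%N by have := king_path_dist pp'; rewrite lp'.
have st : size (take k p') = k by rewrite size_takel.
exists (take k p').
  by have := mem_king_paths (take_path k pp'); rewrite st.
split; first by have := take_uniq k.+1 up'.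
by split=> // x /mem_take /sub.
Qed.

(** Percolation from rare bad events with bounded range of dependence, [L]
    being the range.  There are 9 king moves, so a probability below
    [20 ^- 1] per point of a path makes long bad paths unlikely; the power
    [L * L] pays for keeping only one point out of [L * L]. *)
Section Renormalized.
Variables (R : realType) (d : nat) (p : R) (mu : probability (config d) R).
Hypothesis mup : bernoulli_percolation p mu.
Variables (bad : site -> set (config d)) (W : site -> seq (bond d)) (L : nat) (x : R).
Hypothesis L0 : (0 < L)%N.
Hypothesis W_uniq : forall u, uniq (W u).
Hypothesis badW : forall u, determined (fun b => b \in W u) (bad u).
Hypothesis W_disj : forall u v b, u.1 = v.1 %[mod L] -> u.2 = v.2 %[mod L] ->
  u <> v -> b \in W u -> b \notin W v.
Hypothesis mu_bad : forall u, mu (bad u) = x%:E.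
Hypothesis x_small : x <= (20^-1) ^+ (L * L).

Lemma measurable_bad u : measurable (bad u).
Proof. by have [] := mu_avg mup (fun=> false) (W_uniq u) (@badW u). Qed.

Lemma bad_ge0 : 0 <= x.
Proof. by rewrite -lee_fin -(mu_bad (0, 0)%N) measure_ge0. Qed.

Definition all_bad (s : seq site) : set (config d) :=
  [set w | forall u, u \in s -> bad u w].

Lemma measurable_all_bad s : measurable (all_bad s).
Proof.
elim: s => [|u s IH].
  by rewrite (_ : all_bad [::] = setT) //; apply/seteqP; split.
rewrite (_ : all_bad _ = bad u `&` all_bad s).
  by apply: measurableI => //; apply: measurable_bad.
apply/seteqP; split=> w.
  move=> h; split; first by apply: h; rewrite mem_head.
  by move=> v vs; apply: h; rewrite inE vs orbT.
by move=> [h1 h2] v; rewrite inE => /predU1P[->//|/h2].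
Qed.

(** Some residue class modulo [L] contains at least a fraction
    [1 / L ^ 2] of the points, and inside one class the bad events are
    independent. *)
Lemma mu_all_bad s : uniq s -> (mu (all_bad s) <= (20^-1 ^+ size s)%:E)%E.
Proof.
move=> us.
pose class (r : 'I_L * 'I_L) := [seq u : site <- s | (u.1 %% L == r.1)%N && (u.2 %% L == r.2)%N].
have [r sr] : exists r, (size s <= L * L * size (class r))%N.
  apply: contrapT => /forallNP none.
  have : size s = (\sum_r size (class r))%N.
    rewrite (eq_bigr (fun r : 'I_L * 'I_L => \sum_(u <- s) ((u.1 %% L == r.1) && (u.2 %% L == r.2)))%N); last first.
      by move=> r _; rewrite size_filter -sum1_count big_mkcond; apply: eq_bigr => u _; case: ifP.
    rewrite exchange_big /= -sum1_size; apply: eq_bigr => u _.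
    rewrite (bigD1 (Ordinal (ltn_pmod u.1 L0), Ordinal (ltn_pmod u.2 L0))) //= !eqxx big1 //.
    move=> [i j] /= ne; case: eqP => //= e1; case: eqP => //= e2; case/eqP: ne.
    by congr pair; apply: val_inj.
  move=> e; have lt r : (L * L * size (class r) <= (size s).-1)%N.
    by have := none r; lia.
  have : (L * L * size s <= L * L * (size s).-1)%N.
    rewrite [in X in (X <= _)%N]e big_distrr /=.
    have -> : (L * L * (size s).-1 = \sum_(r : 'I_L * 'I_L) (size s).-1)%N.
      by rewrite sum_nat_const card_prod card_ord.
    by apply: leq_sum => r _; apply: lt.
  rewrite leq_pmul2l ?muln_gt0 ?L0 // => h.
  have s0 : size s = 0%N by lia.
  by apply: (none (Ordinal L0, Ordinal L0)); rewrite s0.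
have sub : all_bad s `<=` all_bad (class r).
  by move=> w ws u; rewrite mem_filter => /andP[_ /ws].
apply: (@le_trans _ _ (mu (all_bad (class r)))).
  by apply: le_measure; rewrite ?inE //; apply: measurable_all_bad.
rewrite (mu_indep mup (S := W) (x := x)) //; last 2 first.
- exact: filter_uniq.
- move=> u v b; rewrite !mem_filter => /andP[/andP[/eqP u1 /eqP u2] _].
  move=> /andP[/andP[/eqP v1 /eqP v2] _]; apply: W_disj; by rewrite ?u1 ?u2.
rewrite lee_fin; apply: (@le_trans _ _ ((20^-1 ^+ (L * L)) ^+ size (class r))).
  by apply: lerXn2r => //; rewrite nnegrE ?bad_ge0 // exprn_ge0.
rewrite -exprM; apply: ler_wiXn2l => //.
by rewrite invf_le1 // ler1n.
Qed.

Definition bad_path (k : nat) : set (config d) :=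
  [set w | exists2 q, q \in [seq q <- king_paths k (k, 0)%N | uniq ((k, 0)%N :: q)] &
             size q = k /\ all_bad ((k, 0)%N :: q) w].

(** There are at most [9 ^ k] paths, each with [k.+1] points, and
    [9 ^ k / 20 ^ k.+1 <= 1 / 2 ^ k.+1]. *)
Lemma mu_bad_path k : measurable (bad_path k) /\ (mu (bad_path k) <= (2 ^+ k.+1)^-1%:E)%E.
Proof.
pose Q := [seq q <- king_paths k (k, 0)%N | uniq ((k, 0)%N :: q)].
have sQ : (size Q <= 9 ^ k)%N by rewrite -(size_king_paths k (k, 0)%N) size_filter count_size.
suff [mQ leQ] : measurable (bad_path k) /\
    (mu (bad_path k) <= ((size Q)%:R * 20^-1 ^+ k.+1)%:E)%E.
  split=> //; apply: le_trans leQ _; rewrite lee_fin.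
  apply: (@le_trans _ _ ((9 ^ k)%:R * 20^-1 ^+ k.+1)).
    by rewrite ler_wpM2r ?ler_nat // exprn_ge0.
  rewrite exprVn ler_pdivrMr ?exprn_gt0 // -ler_pdivrMl ?invr_gt0 ?exprn_gt0 // invrK.
  rewrite -!natrX -natrM ler_nat !expnS -mulnA -expnMn leq_mul //.
  by case: (k) => // k'; rewrite leq_exp2r.
rewrite /bad_path -/Q.
have uQ q : q \in Q -> uniq ((k, 0)%N :: q) by rewrite mem_filter => /andP[].
elim: Q uQ {sQ} => [_|q Q IH uQ].
  rewrite (_ : [set w | _] = set0); last by apply/seteqP; split=> // w [].
  by rewrite measure0 mul0r; split.
have [|mQ leQ] := IH.
  by move=> q' q'Q; apply: uQ; rewrite inE q'Q orbT.
pose A := if size q == k then all_bad ((k, 0)%N :: q) else set0.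
have mA : measurable A by rewrite /A; case: ifP => _ //; apply: measurable_all_bad.
have leA : (mu A <= (20^-1 ^+ k.+1)%:E)%E.
  rewrite /A; case: eqP => [qk|_]; last by rewrite measure0 lee_fin exprn_ge0.
  have := @mu_all_bad ((k, 0)%N :: q); rewrite /= qk; apply.
  by have := uQ q (mem_head _ _).
rewrite (_ : [set w | _] = A `|` [set w | exists2 q, q \in Q & size q = k /\ all_bad ((k, 0)%N :: q) w]).
  split; first exact: measurableU.
  apply: le_trans (measureU2 _ _ _) _ => //.
  by rewrite /= -natr1 mulrDl mul1r addrC EFinD; apply: leeD.
apply/seteqP; split=> w.
  move=> [q']; rewrite inE => /predU1P[->|q'Q] [h1 h2].
    by left; rewrite /A h1 eqxx.
  by right; exists q'.
move=> [|[q' q'Q h]]; last by exists q' => //; rewrite inE q'Q orbT.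
rewrite /A; case: eqP => // qk Aw; exists q => //; exact: mem_head.
Qed.

(** Borel-Cantelli: almost surely, bad paths start from finitely many points
    of the axis, which is what [unbounded_cluster] asks for. *)
Lemma renormalized_percolation :
  {ae mu, forall w, exists u, forall N,
    exists2 v, cluster [set u | ~ bad u w] u v & (N < v.1)%N || (N < v.2)%N}.
Proof.
have mb k : measurable (bad_path k) by have [] := mu_bad_path k.
exists (lim_sup_set bad_path); split.
- by apply: bigcapT_measurable => n; apply: bigcup_measurable.
- apply: lim_sup_set_cvg0 => //.
  apply: le_lt_trans (_ : (1 : R)%:E < +oo)%E; last exact: ltry.
  apply: le_trans (epsilon_trick0 xpredT (@ler01 R)).
  apply: lee_nneseries => [k _ _|k _]; first exact: measure_ge0.
  by rewrite div1r natrX; have [] := mu_bad_path k.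
move=> w /= none n _; apply: contrapT => no_bad; apply: none.
apply: (@unbounded_cluster _ n) => k q nk qq lq.
apply: contrapT => allb; apply: no_bad; exists k; first exact: ltnW.
have [r rk [ur [sr rq]]] := simple_king_path qq lq.
exists r; first by rewrite mem_filter ur.
split=> // v vr; apply: contrapT => gv; apply: allb; exists v => //.
by move: vr; rewrite !inE => /predU1P[->|/rq ->]; rewrite ?eqxx ?orbT.
Qed.

End Renormalized.

(** * The renormalized lattice *)

Lemma congruent_close (n s a b : nat) : (0 < s)%N ->
  `|(s * a)%N%:Z - (s * b)%N%:Z| < (n * s)%N%:Z -> a = b %[mod n] -> a = b.
Proof.
move=> s0; wlog ab : a b / (a <= b)%N.
  move=> W; case: (leqP a b) => [|/ltnW] h lt e; first exact: W.
  by apply/esym/W => //; rewrite distrC.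
move=> lt /esym/eqP; rewrite eqn_mod_dvd // => dv.
have [|ba] := leqP (b - a) 0; first lia.
have : (s * n <= s * (b - a))%N by rewrite leq_mul2l (dvdn_leq ba dv) orbT.
rewrite mulnBr; have := leq_mul (leqnn s) ab; move: lt; rewrite (mulnC n).
by move: (s * a)%N (s * b)%N (s * n)%N => x y z; clear; lia.
Qed.

Section Coarse.
Variables (R : realType) (d : nat) (I : Type) (E : I -> enhancement d).
Hypothesis E0 : forall i, vert (enhS (E i)) 0.
Hypothesis hd : (2 <= d)%N.
Variables (k s : nat).
Hypothesis fill : forall i, scale R E k i ->
  graph_le (box_graph d (2 * s)%N%:Z) (enhS (E i)).

(** The cells live in the plane of the first two coordinates. *)
Definition cell_origin (u : site) : Zd d :=
  \col_l (s * (if val l == 0%N then u.1 else if val l == 1%N then u.2 else 0))%N%:Z.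

Lemma cell_origin_fst u : cell_origin u (Ordinal (ltnW hd)) 0 = (s * u.1)%N%:Z.
Proof. by rewrite mxE. Qed.

Lemma cell_origin_snd u : cell_origin u (Ordinal hd) 0 = (s * u.2)%N%:Z.
Proof. by rewrite mxE. Qed.

Lemma cell_origin_adj u v : grid_adj u v -> @box d s%:Z (cell_origin v - cell_origin u).
Proof.
move=> uv i; rewrite !mxE.
have near1 (a b : nat) : within1 a b -> `|(s * b)%N%:Z - (s * a)%N%:Z| <= s%:Z.
  rewrite /within1 => /andP[h1 h2].
  have := leq_mul (leqnn s) h1; have := leq_mul (leqnn s) h2; rewrite !mulnS.
  by move: (s * a)%N (s * b)%N => x y; clear; lia.
move: uv; rewrite /grid_adj => uv.
by case: eqP => _; [|case: eqP => _]; apply: near1; rewrite /within1; move: uv;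
  [move: (u.1) (u.2) (v.1) (v.2) | move: (u.1) (u.2) (v.1) (v.2) |];
  clear; lia.
Qed.

Definition cell (u : site) : set (Zd d) := [set y | cube0 s (y - cell_origin u)].

Definition good (w : config d) : set site := [set u | anchored R E k (cell u) w].

(** The two properties of the anchor of a good cell on which connectivity
    relies. *)
Definition hub (w : config d) (u : site) (y : Zd d) :=
  cell u y /\ filled (enhanced_graph R E k w) y (2 * s)%N%:Z.

Lemma good_hub w u : good w u -> exists y, hub w u y.
Proof.
move=> [[i g] [/= si Gg aT] /= cu]; exists (g 0); split=> // z l h1 h2.
right; exists (i, g).
  by split=> //; exists k => //=.
exact: (Gamma_filled Gg (fill si)).
Qed.

(** Points of adjacent cells differ by less than [2 * s] in each coordinate,
    so the second anchor lies in the box filled around the first. *)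
Lemma hub_connected w u v y z : grid_adj u v -> hub w u y -> hub w v z ->
  clos_refl_trans _ (adj (enhanced_graph R E k w)) y z.
Proof.
move=> uv [yu fy] [zv _]; apply: (filled_connected fy) => i.
have := yu i; have := zv i; have := cell_origin_adj uv i.
rewrite !mxE; move: (s * _)%N (s * _)%N (y i 0) (z i 0) => a b c e.
by clear; lia.
Qed.

(** The hubs of a cluster of cells lie in one component, and they leave every
    box when the cluster is unbounded. *)
Lemma unbounded_infinite w u :
  (forall N, exists2 v, cluster (good w) u v & (N < v.1)%N || (N < v.2)%N) ->
  (0 < s)%N ->
  has_infinite_component (enhanced_graph R E k w).
Proof.
move=> unb s0.
have [v0 uv0 _] := unb 0%N.
have gu : good w u by elim: uv0.
have [y0 hy0] := good_hub gu.
exists y0; first by left.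
move=> /(@finite_radius _ (Graph (component (enhanced_graph R E k w) y0) set0))[r [/= box_r _]].
have reach v : cluster (good w) u v -> exists2 y, hub w v y &
    clos_refl_trans _ (adj (enhanced_graph R E k w)) y0 y.
  elim=> [_|v' v'' _ [y hy cy] vv gv]; first by exists y0 => //; apply: rt_refl.
  have [z hz] := good_hub gv; exists z => //.
  exact: rt_trans cy (hub_connected vv hy hz).
have [v /reach[y [cy _] yc] far] := unb r.
have big (l : 'I_d) (a : nat) : cell_origin v l 0 = (s * a)%N%:Z -> (a <= r)%N.
  move=> e; have := box_r y yc l; have /andP[h1 h2] := cy l.
  move: h1; rewrite mxE [X in _ + X]mxE e => h1 h3.
  have : (a <= s * a)%N by rewrite leq_pmull.
  move: h1 h3; move: (s * a)%N (y l 0) => b c; clear; lia.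
by have := big _ _ (cell_origin_fst v); have := big _ _ (cell_origin_snd v); lia.
Qed.

Variable n : nat.
Notation m := (2 ^ (k + 3))%N.
Hypothesis mE : m = (n * s)%N.
Hypothesis s0 : (0 < s)%N.

(** Distinct congruent cells are at least [n * s] apart, the side of a
    window. *)
Lemma window_disjoint u v b : u.1 = v.1 %[mod n] -> u.2 = v.2 %[mod n] -> u <> v ->
  b \in window k m (cell_origin u) -> b \notin window k m (cell_origin v).
Proof.
have m1 : (1 < m)%N by rewrite -[1%N]/(2 ^ 0)%N ltn_exp2l // addn3.
move=> e1 e2 uv bu; apply/negP => bv; apply: uv.
have hu : cube0 m (b.1 - window_corner k (cell_origin u)) by exact: (windowP m1 bu).
have hv : cube0 m (b.1 - window_corner k (cell_origin v)) by exact: (windowP m1 bv).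
have dist (l : 'I_d) (a a' : nat) : cell_origin u l 0 = (s * a)%N%:Z -> cell_origin v l 0 = (s * a')%N%:Z ->
    a = a' %[mod n] -> a = a'.
  move=> ea ea' mod_eq; apply: (congruent_close s0 _ mod_eq).
  have := hu l; have := hv l; rewrite /window_corner -mE.
  move: ea ea'; move: (cell_origin u) (cell_origin v) => x y ea ea'; rewrite !mxE ea ea'.
  by move: (b.1 l 0) (s * a)%N (s * a')%N m => c z t r; clear; lia.
by case: u v {hu hv bu bv} e1 e2 dist => u1 u2 [v1 v2] /= e1 e2 dist;
  congr pair; [apply: dist (cell_origin_fst _) (cell_origin_fst _) e1 | apply: dist (cell_origin_snd _) (cell_origin_snd _) e2].
Qed.

(** The range of dependence is [n] cells, the side of a window. *)
Lemma coarse_percolation (p : R) (mu : probability (config d) R) :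
  (0 < n)%N -> (s + 2 * 2 ^ k.+1 <= m)%N ->
  bernoulli_percolation p mu ->
  1 - tprob E k m p (cube0 s) <= 20^-1 ^+ (n * n) ->
  percolates mu (enhanced_graph R E k).
Proof.
move=> n0 sm mup small.
have m1 : (1 < m)%N by rewrite -[1%N]/(2 ^ 0)%N ltn_exp2l // addn3.
pose bad u : set (config d) := ~` anchored R E k (cell u).
have cellP u : cell u `<=` [set y | cube0 s (y - cell_origin u)] by [].
have badW u : determined (fun b => b \in window k m (cell_origin u)) (bad u).
  move=> a b ab na ab'; apply: na; apply: (anchored_window E0 m1 sm (cellP u) _ ab').
  by move=> j /ab.
have mu_bad u : mu (bad u) = (1 - tprob E k m p (cube0 s))%:E.
  have [mA eA] := mu_anchored E0 m1 mup sm (cellP u).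
  by rewrite /bad probability_setC // eA tprob_translate.
have := @renormalized_percolation R d p mu mup bad
  (fun u => window k m (cell_origin u)) n _ n0 (fun u => window_uniq k m (cell_origin u)) badW
  window_disjoint mu_bad small.
apply: filterS => w [u hu]; apply: (@unbounded_infinite w u) => // N.
have [v uv Nv] := hu N; exists v => //.
suff -> : good w = [set u | ~ bad u w] by [].
by apply/seteqP; split=> x; rewrite /good /bad /=; [tauto | exact: contrapT].
Qed.

End Coarse.

Lemma often_large (R : realType) (u : nat -> \bar R) :
  (forall k, 0 <= u k)%E -> limn_esup u <> 0%E ->
  exists2 delta : R, 0 < delta & forall n, exists2 k, (n <= k)%N & (delta%:E <= u k)%E.
Proof.
move=> u0 neq; apply: contrapT => none; apply: neq.
have small (delta : R) : 0 < delta -> exists n, forall k, (n <= k)%N -> (u k < delta%:E)%E.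
  move=> delta0; apply: contrapT => /forallNP h; apply: none; exists delta => // n.
  have /existsNP[k /not_implyP[nk uk]] := h n; exists k => //.
  by rewrite leNgt; apply/negP.
suff cv : (u x @[x --> \oo] --> 0%E)%classic by rewrite (cvg_limn_einf_sup cv).2.
apply/fine_cvgP; split.
  have [n hn] := small 1 ltr01; exists n => // k /= nk.
  by rewrite ge0_fin_numE //; apply: lt_trans (hn k nk) (ltry _).
apply/cvgrPdist_lt => e e0; have [n hn] := small e e0; exists n => // k /= nk.
rewrite sub0r normrN; have := hn k nk; have := u0 k.
by case: (u k) => [r| |] //=; rewrite lee_fin lte_fin => r0 re; rewrite ger0_norm.
Qed.

Theorem theorem15 (R : realType) (d : nat) (hd : (2 <= d)%N)
    (Pr : R -> probability (config d) R)
    (hPr : forall p : R, 0 <= p <= 1 -> bernoulli_percolation p (Pr p))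
    (I : Type) (E : I -> enhancement d)
    (hE : enhancement_family R E) (hrot : rotund R E)
    (p : R) (hp : 0 <= p <= 1) (hqc : q_c Pr E < p) :
  exists N : nat, percolates (Pr p) (enhanced_graph R E N).
Proof.
have [_ E0] := hE; have [p_0 p_1] := andP hp.
set S := [set p : R | 0 <= p <= 1 /\
  limn_esup (fun k => Pr p (anchor_event R E k)) = 0%E].
have ubS : has_ubound S by exists 1 => q [/andP[]].
(* [q_c] is a supremum of nonnegative numbers, or 0 by convention. *)
have qc0 : 0 <= q_c Pr E.
  rewrite /q_c -/S; have [->|/set0P[q Sq]] := eqVneq S set0; first by rewrite sup0.
  by apply: le_trans (ub_le_sup ubS Sq); case: Sq => /andP[].
(* Leaves room for the sharp threshold between [p1] and [p]. *)
pose p1 := (q_c Pr E + p) / 2.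
have p1p : p1 < p by rewrite /p1; lra.
have p10 : 0 <= p1 by rewrite /p1; lra.
have qp1 : q_c Pr E < p1 by rewrite /p1; lra.
have p1_01 : 0 <= p1 <= 1 by lra.
have [delta delta0 often] : exists2 delta : R, 0 < delta &
    forall n, exists2 k, (n <= k)%N & (delta%:E <= Pr p1 (anchor_event R E k))%E.
  apply: often_large => [k|lim0]; first exact: measure_ge0.
  by have := ub_le_sup ubS (conj p1_01 lim0); rewrite -/(q_c Pr E) leNgt qp1.
have [h fill] := scale_fill E0 hrot.
pose n := (2 ^ (h + 3))%N.
have n0 : (0 < n)%N by rewrite expn_gt0.
have eta0 : 0 < 20^-1 ^+ (n * n) :> R by rewrite exprn_gt0 // invr_gt0.
have [k hk dense] :=
  dense_anchors E0 (ltnW hd) h (hPr p1 p1_01) p10 p1p p_1 delta0 eta0 often.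
have s0 : (0 < 2 ^ (k - h))%N by rewrite expn_gt0.
exists k; apply: (@coarse_percolation R d I E E0 hd k (2 ^ (k - h))%N _ n _ s0 p) => //.
- by move=> i; apply: fill.
- by rewrite /n -expnD; congr expn; lia.
- have : (2 ^ (k - h) <= 2 ^ k)%N by rewrite leq_exp2l // leq_subr.
  by rewrite addn3 !expnS; lia.
exact: hPr.
Qed.
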